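(* Let $n\ge 1$, $d\ge 1$, and let $\eta^{(i)}_j\ge 0$ ($i,j\in[n]$) be fixed coefficients. Consider the party model: $n$ agents with opinions in $\mathbb{S}^{d-1}$ updated by $$\mathbf{X}_{t+1}^{(i)}=P_{\mathbb{S}^{d-1}}\Big(\mathbf{X}_t^{(i)}+\sum_{j:\,\mathrm{sgn}\langle\mathbf{X}_t^{(j)},\xi_t\rangle=\mathrm{sgn}\langle\mathbf{X}_t^{(i)},\xi_t\rangle}\eta^{(i)}_j\mathbf{X}_t^{(j)}-\sum_{j:\,\mathrm{sgn}\langle\mathbf{X}_t^{(j)},\xi_t\rangle\neq\mathrm{sgn}\langle\mathbf{X}_t^{(i)},\xi_t\rangle}\eta^{(i)}_j\mathbf{X}_t^{(j)}\Big),$$ where $\xi_0,\xi_1,\ldots$ are i.i.d. from a distribution $\mathcal{D}$ on $\mathbb{S}^{d-1}$ for which there exist $C,C'>0$ with $C\mu(B)\le\Pr(\xi_t\in B)\le C'\mu(B)$ for all measurable $B\subseteq\mathbb{S}^{d-1}$, $\mu$ being the uniform (Haar) probability measure. Let $A$ be the $n\times n$ matrix with $A_{ij}=1$ if $\eta^{(i)}_j>0$ and $A_{ij}=0$ otherwise, and suppose $A$ is irreducible, i.e., $A^n>0$ entrywise. Then for every starting configuration $\mathbf{X}_0\in(\mathbb{S}^{d-1})^n$, almost surely $\rho(\mathbf{X}_t,P)\to 0$ (the system strongly polarizes).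
   Context: $\mathbb{S}^{d-1}$ is the unit sphere in $\mathbb{R}^d$, $P_{\mathbb{S}^{d-1}}(\mathbf{x})=\mathbf{x}/\|\mathbf{x}\|_2$, $\mathrm{sgn}(0)=0$; as a standing assumption of the model, the unnormalized vector inside $P_{\mathbb{S}^{d-1}}$ is assumed nonzero so the normalization is well-defined. The polarized set is $P=\{(\sigma_1\mathbf{x},\ldots,\sigma_n\mathbf{x}):\mathbf{x}\in\mathbb{S}^{d-1},\ \bm{\sigma}\in\{-1,1\}^n\}$ and $\rho(\mathbf{z},P)=\inf_{\mathbf{y}\in P}\|\mathbf{z}-\mathbf{y}\|_2$ (Euclidean distance in $(\mathbb{R}^d)^n$). *)

(* Defs.v *)
From HB Require Import structures.
From mathcomp Require Import all_boot all_order all_algebra.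
From mathcomp Require Import all_classical all_reals all_analysis.
Set Implicit Arguments. Unset Strict Implicit. Unset Printing Implicit Defensive.
Import Order.TTheory GRing.Theory Num.Theory.
Local Open Scope classical_set_scope.
Local Open Scope ring_scope.

(* Vectors of R^d are represented as d.-tuple R, which carries the product
   sigma-algebra (= Borel sigma-algebra of R^d). *)

Definition dotv (R : realType) (d : nat) (x y : d.-tuple R) : R :=
  \sum_(k < d) tnth x k * tnth y k.

Definition normv (R : realType) (d : nat) (x : d.-tuple R) : R :=
  Num.sqrt (dotv x x).

Definition proj_sphere (R : realType) (d : nat) (x : d.-tuple R) : d.-tuple R :=
  [tuple (normv x)^-1 * tnth x k | k < d].

Definition sphere (R : realType) (d : nat) : set (d.-tuple R) :=
  [set x | normv x = 1].
Arguments sphere {R} d.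

Definition party_unnorm (R : realType) (n d : nat) (eta : 'I_n -> 'I_n -> R)
    (X : 'I_n -> d.-tuple R) (xi : d.-tuple R) (i : 'I_n) : d.-tuple R :=
  [tuple tnth (X i) k
         + \sum_(j < n | Num.sg (dotv (X j) xi) == Num.sg (dotv (X i) xi))
              eta i j * tnth (X j) k
         - \sum_(j < n | Num.sg (dotv (X j) xi) != Num.sg (dotv (X i) xi))
              eta i j * tnth (X j) k
   | k < d].

Definition party_step (R : realType) (n d : nat) (eta : 'I_n -> 'I_n -> R)
    (X : 'I_n -> d.-tuple R) (xi : d.-tuple R) : 'I_n -> d.-tuple R :=
  fun i => proj_sphere (party_unnorm eta X xi i).

Fixpoint party_traj (R : realType) (n d : nat) (eta : 'I_n -> 'I_n -> R)
    (X0 : 'I_n -> d.-tuple R) (xi : nat -> d.-tuple R) (t : nat)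
    : 'I_n -> d.-tuple R :=
  match t with
  | 0 => X0
  | t'.+1 => party_step eta (party_traj eta X0 xi t') (xi t')
  end.

Definition polar_dist (R : realType) (n d : nat) (z : 'I_n -> d.-tuple R) : R :=
  inf [set r : R | exists (x : d.-tuple R) (sigma : 'I_n -> bool),
         sphere d x /\
         r = Num.sqrt (\sum_(i < n) \sum_(k < d)
                (tnth (z i) k - (-1) ^+ sigma i * tnth x k) ^+ 2)].

Definition adj_matrix (R : realType) (n : nat) (eta : 'I_n -> 'I_n -> R) : 'M[R]_n :=
  \matrix_(i < n, j < n) (if 0 < eta i j then 1 else 0).

Definition orthogonal_map (R : realType) (d : nat) (Q : d.-tuple R -> d.-tuple R) :=
  forall x y, dotv (Q x) (Q y) = dotv x y.

Definition is_uniform_sphere_measure (R : realType) (d : nat)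
    (mu : probability (d.-tuple R) R) :=
  mu (sphere d) = 1%E /\
  forall Q, orthogonal_map Q ->
    forall B : set (d.-tuple R), measurable B -> mu (Q @^-1` B) = mu B.

Definition mutually_independent (R : realType) (dT : measure_display)
    (T : measurableType dT) (P : probability T R) (dU : measure_display)
    (U : measurableType dU) (X : nat -> T -> U) :=
  forall (s : seq nat) (B : nat -> set U), uniq s ->
    (forall t, measurable (B t)) ->
    P (\bigcap_(t in [set` s]) (X t @^-1` B t)) =
    (\prod_(t <- s) P (X t @^-1` B t))%E.

Definition identically_distributed (R : realType) (dT : measure_display)
    (T : measurableType dT) (P : probability T R) (dU : measure_display)
    (U : measurableType dU) (X : nat -> T -> U) :=
  forall t (B : set U), measurable B -> P (X t @^-1` B) = P (X 0%N @^-1` B).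

(* Main.v *)
(* Flip each opinion so that all of them lie on the positive side of the current
   xi. As long as later sign patterns agree with this orientation, the flipped
   opinions follow a consensus dynamics, which by irreducibility contracts
   geometrically, at a rate depending only on the margin of the flipped opinions
   in some direction v. By pigeonhole over the 2^n orientations, a fresh
   orientation with margin c has probability at least kappa, uniformly in the
   configuration, and the cone of consistent xi only grows along the run. On the
   other hand inconsistency forces xi into a slab around the cluster whose width
   decays geometrically, and the measure of a slab is at most a power of its
   width. So a run survives forever with probability bounded below, the number
   of failed runs has finite expectation, and almost surely one run never ends.
   Since the dynamics sees xi only through finitely many sign patterns, the
   trajectory lives on a finitely branching tree, whose cylinders have product
   probabilities by independence. *)

Require Import Defs.
From HB Require Import structures.
From mathcomp Require Import all_boot all_order all_algebra.
From mathcomp Require Import all_classical all_reals all_analysis.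
From mathcomp Require Import perm measurable_realfun zify ring lra.
Import Order.TTheory GRing.Theory Num.Theory.
Local Open Scope classical_set_scope.
Local Open Scope ring_scope.

Set Implicit Arguments.
Unset Strict Implicit.
Unset Printing Implicit Defensive.

(** * Vectors and the sphere *)

Section Vectors.
Context {R : realType} {d : nat}.
Implicit Types x y z u : d.-tuple R.

Lemma dotvC x y : dotv x y = dotv y x.
Proof. by apply: eq_bigr => k _; rewrite mulrC. Qed.

Lemma dotv_ge0 x : 0 <= dotv x x.
Proof. by apply: sumr_ge0 => k _; rewrite -expr2 sqr_ge0. Qed.

Lemma dotv_tupleD a b x y u :
  dotv [tuple a * tnth x k + b * tnth y k | k < d] u = a * dotv x u + b * dotv y u.
Proof.
rewrite /dotv !mulr_sumr -big_split /=; apply: eq_bigr => k _.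
by rewrite tnth_mktuple mulrDl !mulrA.
Qed.

Lemma dotv_tuple_sum (I : finType) (a : I -> R) (x : I -> d.-tuple R) u :
  dotv [tuple \sum_i a i * tnth (x i) k | k < d] u = \sum_i a i * dotv (x i) u.
Proof.
under [RHS]eq_bigr do rewrite mulr_sumr.
rewrite exchange_big /=; apply: eq_bigr => k _.
by rewrite tnth_mktuple mulr_suml; apply: eq_bigr => i _; rewrite mulrA.
Qed.

Lemma dotv_tupleZ a x u :
  dotv [tuple a * tnth x k | k < d] u = a * dotv x u.
Proof.
rewrite /dotv mulr_sumr; apply: eq_bigr => k _.
by rewrite tnth_mktuple mulrA.
Qed.

Lemma sphereP x : sphere d x <-> dotv x x = 1.
Proof.
rewrite /sphere/= /normv; split=> [h|->]; last by rewrite sqrtr1.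
by rewrite -(sqr_sqrtr (dotv_ge0 x)) h expr1n.
Qed.

Lemma dotv_eq0 x : dotv x x = 0 -> x = [tuple 0 | _ < d].
Proof.
move=> /eqP; rewrite psumr_eq0 => [/allP h|k _]; last by rewrite -expr2 sqr_ge0.
apply: eq_from_tnth => k; rewrite tnth_mktuple.
by have := h k (mem_index_enum _); rewrite /= -expr2 sqrf_eq0 => /eqP.
Qed.

Lemma normv_gt0 x : (0 < normv x) = (x != [tuple 0 | _ < d]).
Proof.
rewrite /normv sqrtr_gt0 lt_neqAle dotv_ge0 andbT eq_sym; congr (~~ _).
apply/eqP/eqP => [/dotv_eq0//|->].
by rewrite /dotv big1// => k _; rewrite tnth_mktuple mul0r.
Qed.

Lemma dotv_proj x u : dotv (proj_sphere x) u = (normv x)^-1 * dotv x u.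
Proof. exact: dotv_tupleZ. Qed.

Lemma proj_sphereP x : x != [tuple 0 | _ < d] -> sphere d (proj_sphere x).
Proof.
rewrite -normv_gt0 => h; apply/sphereP.
rewrite dotv_proj dotvC dotv_proj -(sqr_sqrtr (dotv_ge0 x)) -/(normv x).
by rewrite mulrA -expr2 -exprMn mulVf ?expr1n// gt_eqF.
Qed.

Lemma dotv_sphere_le1 x y : sphere d x -> sphere d y -> dotv x y <= 1.
Proof.
move=> /sphereP hx /sphereP hy.
pose w := [tuple 1 * tnth x k + -1 * tnth y k | k < d].
have E u : dotv w u = dotv x u - dotv y u by rewrite dotv_tupleD; lra.
have := dotv_ge0 w; rewrite E !(dotvC _ w) !E hx hy (dotvC y x) => h; lra.
Qed.

Lemma sphere_coord_le1 x k : sphere d x -> `|tnth x k| <= 1.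
Proof.
move=> /sphereP hx; rewrite -(@expr_le1 _ 2) // real_normK ?num_real // -hx.
rewrite /dotv (bigD1 k)//= -expr2 lerDl.
by apply: sumr_ge0 => i _; rewrite -expr2 sqr_ge0.
Qed.

Lemma measurable_dotv y : measurable_fun setT (fun x => dotv x y).
Proof.
apply: measurable_sum => k.
by apply: measurable_funM; [exact: measurable_tnth|exact: measurable_cst].
Qed.

Lemma measurable_sphere : measurable (sphere d : set (d.-tuple R)).
Proof.
have -> : sphere d = (fun x => dotv x x) @^-1` [set 1].
  by apply/seteqP; split=> x; rewrite /= => /sphereP.
rewrite -[X in measurable X]setTI.
have : measurable_fun setT (fun x : d.-tuple R => dotv x x).
  by apply: measurable_sum => k; apply: measurable_funM; exact: measurable_tnth.
by apply => //; exact: measurable_set1.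
Qed.

Lemma measurable_dotv_set y (B : set R) :
  measurable B -> measurable [set x | B (dotv x y)].
Proof.
by move=> mB; rewrite -[X in measurable X]setTI; exact: measurable_dotv.
Qed.

(** The witness is the Householder reflection along [y - y']; as the two norms agree, it exchanges
    [y] and [y']. It serves to show that slabs around vectors of equal norm have equal uniform
    measure. *)
Lemma reflection_swap y y' : dotv y y = dotv y' y' ->
  exists2 Q, orthogonal_map Q & forall x, dotv (Q x) y' = dotv x y.
Proof.
move=> yy'; have [->|ne] := eqVneq y y'; first by exists id.
pose u : d.-tuple R := [tuple 1 * tnth y k + -1 * tnth y' k | k < d].
have du x : dotv x u = dotv x y - dotv x y'.
  by rewrite dotvC dotv_tupleD (dotvC x y) (dotvC x y') mul1r mulN1r.
have uu0 : dotv u u != 0.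
  apply: contra ne => /eqP /dotv_eq0 /(congr1 (fun t => tnth t)) h; apply/eqP.
  apply: eq_from_tnth => k; move: (congr1 (fun f => f k) h).
  by rewrite !tnth_mktuple; lra.
pose Q x : d.-tuple R :=
  [tuple 1 * tnth x k + - (2 * dotv x u / dotv u u) * tnth u k | k < d].
have QE x z : dotv (Q x) z = dotv x z - 2 * dotv x u / dotv u u * dotv u z.
  by rewrite dotv_tupleD mul1r mulNr.
exists Q.
  move=> x z; rewrite QE !(dotvC _ (Q z)) !QE (dotvC z x) (dotvC u x) (dotvC z u).
  by field.
move=> x; rewrite QE.
have := uu0; rewrite (du u) (dotvC u y) (dotvC u y') !du (dotvC y' y) yy' => h.
by field.
Qed.

End Vectors.

(** * Measure of slabs *)

Section Slabs.
Context {R : realType} {d : nat}.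
Hypothesis d_gt0 : (0 < d)%N.

Definition slab (y : d.-tuple R) (e : R) : set (d.-tuple R) :=
  [set x | sphere d x /\ `|dotv x y| <= e].

(** A point of the moment curve: any [d] of them with distinct parameters are the columns of an
    invertible Vandermonde matrix. *)
Definition moment_vec (t : nat) : d.-tuple R := [tuple t%:R ^+ k | k < d].

Lemma measurable_slab y e : measurable (slab y e).
Proof.
apply: measurableI; first exact: measurable_sphere.
have -> : (fun x => is_true (`|dotv x y| <= e)) =
    [set x | [set r : R | r \in `[-e, e]] (dotv x y)].
  by apply/funext => x; rewrite /= in_itv/= ler_norml.
by apply: (@measurable_dotv_set _ _ y); exact: measurable_itv.
Qed.

(** The determinant is a product of differences of distinct natural numbers, each of absolute value
    at least 1. *)
Lemma det_Vandermonde_nat_ge1 (t : 'I_d -> nat) : injective t ->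
  1 <= `|\det (Vandermonde d (\row_i (t i)%:R : 'rV[R]_d))|.
Proof.
move=> tI; rewrite det_Vandermonde normr_prod.
elim/big_ind: _ => [//|a b a1 b1|i _]; first exact: mulr_ege1.
rewrite normr_prod.
elim/big_ind: _ => [//|a b a1 b1|j ij]; first exact: mulr_ege1.
rewrite !mxE -normrN opprB.
have : t i != t j by apply: contraTneq ij => /tI ->; rewrite ltnn.
rewrite neq_ltn => /orP[h|h].
  by rewrite distrC -natrB ?(ltnW h)// ger0_norm// ler1n subn_gt0.
by rewrite -natrB ?(ltnW h)// ger0_norm// ler1n subn_gt0.
Qed.

(** In the Leibniz expansion every term is a product of at most [d] entries, hence at most [M ^+ d]
    since [M] is at least 1. *)
Lemma cofactor_bound (M : R) (A : 'M[R]_d) i j : 1 <= M ->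
  (forall i j, `|A i j| <= M) -> `|cofactor A i j| <= #|{perm 'I_d}|%:R * M ^+ d.
Proof.
move=> M1 hA; rewrite expand_cofactor.
apply: le_trans (ler_norm_sum _ _ _) _.
apply: (@le_trans _ _ (\sum_(s : {perm 'I_d}) M ^+ d)); last first.
  by rewrite sumr_const mulr_natl.
rewrite [leRHS](bigID (fun s : {perm 'I_d} => s i == j))/=.
apply: ler_wpDr.
  by apply: sumr_ge0 => s _; rewrite exprn_ge0// (le_trans ler01).
apply: ler_sum => s _; rewrite normrM normrX normrN1 expr1n mul1r normr_prod.
apply: (@le_trans _ _ (\prod_(k | i != k) M)).
  by apply: ler_prod => k _; rewrite normr_ge0 hA.
by rewrite prodr_const ler_weXn2l// -[leqRHS]card_ord max_card.
Qed.

(** A vector almost orthogonal to [d] distinct moment vectors solves a Vandermonde system with tiny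
    right-hand side, so its coordinates are too small for a unit vector. The loss is polynomial in
    [N]. *)
Lemma moment_separation : exists L : R, exists D : nat, [/\ 1 <= L, (1 <= D)%N &
  forall (N : nat) (t : 'I_d -> nat) (x : d.-tuple R),
    (forall i, t i < N)%N -> injective t ->
    (forall i, `|dotv x (moment_vec (t i))| <= (L * N%:R ^+ D)^-1) ->
    ~ sphere d x].
Proof.
have [K K1 cofK] : exists2 K : R, 1 <= K & forall (M : R) (A : 'M[R]_d) i j,
    1 <= M -> (forall i j, `|A i j| <= M) -> `|cofactor A i j| <= K * M ^+ d.
  exists #|{perm 'I_d}|%:R; first by rewrite ler1n; apply/card_gt0P; exists 1%g.
  exact: cofactor_bound.
have d1 : 1 <= d%:R :> R by rewrite ler1n.
(* Entries up to [N ^+ d] give cofactors up to [K * N ^+ (d * d)]; summing [d] of them must leave at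
   most [(2 * d)^-1] per coordinate. *)
exists (2 * d%:R ^+ 2 * K), (d * d)%N; split.
- apply: mulr_ege1 => //; apply: mulr_ege1; first by rewrite ler1n.
  exact: exprn_ege1.
- by rewrite muln_gt0 d_gt0.
move=> N t x tN tI small xS.
have N1 : 1 <= N%:R :> R.
  by rewrite ler1n; apply: leq_ltn_trans (tN (Ordinal d_gt0)).
pose V := Vandermonde d (\row_i (t i)%:R : 'rV[R]_d).
pose v : 'rV[R]_d := \row_k tnth x k.
have vV : v *m V = \row_i dotv x (moment_vec (t i)).
  apply/rowP => i; rewrite !mxE; apply: eq_bigr => k _.
  by rewrite !mxE tnth_mktuple.
have Vb i j : `|V i j| <= N%:R ^+ d.
  rewrite !mxE normrX ger0_norm// (@le_trans _ _ (N%:R ^+ i))//.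
    by apply: lerXn2r; rewrite ?nnegrE// ler_nat ltnW.
  by rewrite ler_weXn2l// ltnW.
pose e : R := (2 * d%:R ^+ 2 * K * N%:R ^+ (d * d))^-1.
have coord k : `|tnth x k| <= (2 * d%:R)^-1.
  have := congr1 (fun M : 'rV_d => M 0 k) (congr1 (mulmxr (\adj V)) vV).
  rewrite /= -mulmxA mul_mx_adj mul_mx_scalar !mxE => xk.
  apply: (@le_trans _ _ `|\det V * tnth x k|).
    by rewrite normrM ler_peMl// det_Vandermonde_nat_ge1.
  rewrite xk; apply: le_trans (ler_norm_sum _ _ _) _.
  apply: (@le_trans _ _ (\sum_(i < d) e * (K * (N%:R ^+ d) ^+ d))).
    apply: ler_sum => i _; rewrite normrM ler_pM// !mxE.
      exact: small.
    by apply: cofK => //; rewrite exprn_ege1.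
  rewrite sumr_const card_ord -[leLHS]mulr_natl -exprM /e.
  have : N%:R ^+ (d * d) != 0 :> R by rewrite expf_neq0// gt_eqF// (lt_le_trans ltr01).
  have : K != 0 by rewrite gt_eqF// (lt_le_trans ltr01).
  have : d%:R != 0 :> R by rewrite gt_eqF// (lt_le_trans ltr01).
  move: (N%:R ^+ (d * d)) (d%:R : R) => X D D0 K0 X0.
  by rewrite le_eqVlt; apply/orP; left; apply/eqP; field; rewrite D0 K0 X0.
have : dotv x x <= 2^-1.
  apply: (@le_trans _ _ (\sum_(k < d) (2 * d%:R)^-1)).
    apply: ler_sum => k _; apply: le_trans (ler_norm _) _.
    by rewrite -[leRHS]mul1r normrM ler_pM// sphere_coord_le1.
  rewrite sumr_const card_ord -[leLHS]mulr_natl le_eqVlt; apply/orP; left; apply/eqP.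
  by field; rewrite gt_eqF// (lt_le_trans ltr01).
by move/sphereP: xS => ->; lra.
Qed.

Section UniformMeasure.
Variable mu : probability (d.-tuple R) R.
Hypothesis mu_unif : is_uniform_sphere_measure mu.

Lemma slab_invariant y y' e : dotv y y = dotv y' y' -> mu (slab y e) = mu (slab y' e).
Proof.
move=> /reflection_swap[Q Qo QE].
rewrite -(mu_unif.2 Q Qo (slab y' e)); last exact: measurable_slab.
by congr (mu _); apply/seteqP; split => x; rewrite /preimage /slab /= QE !sphereP Qo.
Qed.

Lemma moment_vec_neq0 t : moment_vec t != [tuple 0 | _ < d].
Proof.
apply/eqP => /(congr1 (fun x => tnth x (Ordinal d_gt0))).
by rewrite !tnth_mktuple/= expr0; apply/eqP; rewrite oner_eq0.
Qed.

Lemma normv_moment_vec_le t N : (t < N)%N ->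
  normv (moment_vec t) <= d%:R * N%:R ^+ d.
Proof.
move=> tN; have N1 : 1 <= N%:R :> R by rewrite ler1n (leq_ltn_trans _ tN).
have dN0 : 0 <= d%:R * N%:R ^+ d :> R by rewrite mulr_ge0// exprn_ge0.
rewrite -(ger0_norm dN0) -sqrtr_sqr ler_sqrt ?sqr_ge0//.
apply: (@le_trans _ _ (\sum_(k < d) (N%:R ^+ d) ^+ 2)).
  apply: ler_sum => k _; rewrite tnth_mktuple -expr2.
  apply: lerXn2r; rewrite ?nnegrE ?exprn_ge0//.
  apply: (@le_trans _ _ (N%:R ^+ k)); last by rewrite ler_weXn2l// ltnW.
  by apply: lerXn2r; rewrite ?nnegrE// ler_nat ltnW.
rewrite sumr_const card_ord -[leLHS]mulr_natl exprMn ler_wpM2r ?sqr_ge0//.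
by rewrite expr2 ler_peMl// ler1n.
Qed.

(* At most d - 1 of the N slabs orthogonal to moment vectors contain a given
   point of the sphere, and by invariance they all have the same measure. *)
Lemma slab_measure_le : exists L : R, exists D : nat, [/\ 1 <= L, (1 <= D)%N &
  forall (N : nat) (y : d.-tuple R) e, (0 < N)%N -> sphere d y ->
    e <= (L * N%:R ^+ D)^-1 -> (mu (slab y e) <= (d%:R / N%:R)%:E)%E].
Proof.
have [L [D [L1 D1 sep]]] := moment_separation.
have d1 : 1 <= d%:R :> R by rewrite ler1n.
(* The extra factor [d * N ^+ d] bounds the norms of the moment vectors, which are normalized below
   so as to be comparable with [y]. *)
exists (L * d%:R), (D + d)%N; split; [exact: mulr_ege1|by rewrite addn_gt0 D1|].
move=> N y e N0 yS eLN.
have N1 : 1 <= N%:R :> R by rewrite ler1n.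
pose S (t : 'I_N) := slab (proj_sphere (moment_vec t)) e.
have muS t : mu (S t) = mu (slab y e).
  apply: slab_invariant.
  have /sphereP -> := proj_sphereP (moment_vec_neq0 t).
  by move/sphereP : yS.
have mS t : measurable (S t) by exact: measurable_slab.
have count x : \sum_(t < N) (\1_(S t) x : R) <= d%:R.
  pose A := [pred t : 'I_N | `[< S t x >]].
  have -> : \sum_(t < N) (\1_(S t) x : R) = #|A|%:R.
    rewrite -sum1_card natr_sum [RHS]big_mkcond; apply: eq_bigr => t _.
    rewrite indicE (_ : (x \in S t) = (t \in A)); first by case: ifP.
    by rewrite [in RHS]inE; apply/idP/asboolP; rewrite inE.
  rewrite ler_nat leqNgt; apply/negP => dA.
  pose t (i : 'I_d) := enum_val (widen_ord (ltnW dA) i).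
  have tA i : S (t i) x 
    by apply/asboolP; exact: (enum_valP (widen_ord (ltnW dA) i)).
  have [xS _] := tA (Ordinal d_gt0).
  apply: (sep N (fun i => val (t i)) x) => // [i||i].
  - exact: ltn_ord.
  - move=> i j /val_inj /enum_val_inj /(congr1 val) /= ij; exact: val_inj.
  have [_] := tA i; rewrite dotvC dotv_proj dotvC normrM normfV.
  have n0 : 0 < normv (moment_vec (t i)) by rewrite normv_gt0 moment_vec_neq0.
  rewrite (gtr0_norm n0) mulrC ler_pdivrMr// => /le_trans; apply.
  apply: (@le_trans _ _ ((L * d%:R * N%:R ^+ (D + d))^-1 * (d%:R * N%:R ^+ d))).
    apply: ler_pM => //; last exact: normv_moment_vec_le.
      have [_] := tA i; exact: le_trans.
    exact: ltW.
  rewrite exprD.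
  have X0 : N%:R ^+ D != 0 :> R by rewrite expf_neq0// gt_eqF// (lt_le_trans ltr01).
  have Y0 : N%:R ^+ d != 0 :> R by rewrite expf_neq0// gt_eqF// (lt_le_trans ltr01).
  have L0 : L != 0 by rewrite gt_eqF// (lt_le_trans ltr01).
  have d0 : d%:R != 0 :> R by rewrite gt_eqF// (lt_le_trans ltr01).
  move: (N%:R ^+ D) (N%:R ^+ d) (d%:R : R) X0 Y0 d0 => X Y d' X0 Y0 d0.
  by rewrite le_eqVlt; apply/orP; left; apply/eqP; field; rewrite X0 Y0 L0 d0.
(* Double counting: the pointwise bound on the number of slabs through [x] is integrated against
   [mu]. *)
have : (\sum_(t < N) mu (S t) <= d%:R%:E)%E.
  under eq_bigr do rewrite -[S _]setIT -(integral_indic _ measurableT)//.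
  rewrite -ge0_integral_sum//; last first.
    by move=> t; apply/measurable_EFinP; exact: measurable_indic.
     apply: (@le_trans _ _ (\int[mu]_(x in setT) (d%:R)%:E)%E).
    apply: ge0_le_integral => //.
    - by move=> x _; apply: sume_ge0 => t _; rewrite lee_fin.
    - apply: emeasurable_sum => t; apply/measurable_EFinP; exact: measurable_indic.
    - by move=> x _; rewrite sumEFin lee_fin; exact: count.
  rewrite integral_cst// -[leRHS]mule1 lee_wpmul2l//; exact: probability_le1.
have fin : mu (slab y e) \is a fin_num by rewrite fin_num_measure//; exact: measurable_slab.
rewrite (eq_bigr (fun=> (fine (mu (slab y e)))%:E)) => [|t _]; last by rewrite fineK.
rewrite sumEFin sumr_const card_ord -(fineK fin) !lee_fin -[X in X <= _ -> _]mulr_natr.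
by rewrite ler_pdivlMr// (lt_le_trans ltr01).
Qed.

End UniformMeasure.

End Slabs.

(** * Geometric rates *)

Section Geometric.
Context {R : realType}.

Lemma bernoulli_le (x : R) n : 0 <= x <= 1 -> 1 - n%:R * x <= (1 - x) ^+ n.
Proof.
move=> /andP[x0 x1]; elim: n => [|n IH]; first by rewrite mul0r subr0 expr0.
rewrite exprSr; apply: le_trans (ler_wpM2r _ IH); last by rewrite subr_ge0.
rewrite -natr1 -subr_ge0.
have -> : (1 - n%:R * x) * (1 - x) - (1 - (n%:R + 1) * x) = n%:R * (x * x) by ring.
by rewrite !mulr_ge0.
Qed.

(** Bernoulli's inequality for [r = 1 - (1 - g) / n], which replaces an exact [n]-th root. *)
Lemma geometric_root (g : R) n : (0 < n)%N -> 0 < g < 1 ->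
  exists2 r, 0 < r < 1 & g <= r ^+ n.
Proof.
move=> n0 /andP[g0 g1].
have n1 : 1 <= n%:R :> R by rewrite ler1n.
have n_gt0 : 0 < n%:R :> R by rewrite ltr0n.
have x01 : 0 < (1 - g) / n%:R < 1.
  by rewrite divr_gt0 ?subr_gt0//= ltr_pdivrMr// mul1r; lra.
exists (1 - (1 - g) / n%:R).
  by move: x01 => /andP[? ?]; apply/andP; split; lra.
apply: le_trans (bernoulli_le n _); last by move: x01 => /andP[? ?]; rewrite !ltW.
by rewrite mulrC divfK ?gt_eqF//; lra.
Qed.

(** Turns a contraction once every [n] steps into a rate per step; the constant [(r ^+ n)^-1] pays
    for the incomplete last block. *)
Lemma geometric_divn (g : R) n : (0 < n)%N -> 0 < g < 1 ->
  exists B r, [/\ 0 < B, 0 < r < 1 & forall k, g ^+ (k %/ n) <= B * r ^+ k].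
Proof.
move=> n0 g01; have [r r01 gr] := geometric_root n0 g01.
move: g01 r01 => /andP[g0 g1] /andP[r0 r1].
exists (r ^+ n)^-1, r; split; [by rewrite invr_gt0 exprn_gt0|by rewrite r0|].
move=> k; rewrite mulrC ler_pdivlMr ?exprn_gt0//.
apply: (@le_trans _ _ ((r ^+ n) ^+ (k %/ n) * r ^+ n)).
  rewrite ler_wpM2r ?exprn_ge0 ?(ltW r0)//.
  by apply: lerXn2r; rewrite ?nnegrE ?exprn_ge0// ltW.
rewrite -exprM -exprD ler_wiXn2l ?ltW//.
by rewrite {1}(divn_eq k n) mulnC leq_add2l ltnW// ltn_mod.
Qed.

Lemma geometric_small (B r e : R) : 0 < B -> 0 < r < 1 -> 0 < e -> exists k, B * r ^+ k <= e.
Proof.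
move=> B0 /andP[r0 r1] e0.
have /cvgrPdist_le/(_ (e / B)) : (fun k => r ^+ k) @ \oo --> 0.
  by apply: cvg_expr; rewrite gtr0_norm.
move=> /(_ (divr_gt0 e0 B0))[k _ /(_ k (leqnn k))] /=.
rewrite sub0r normrN gtr0_norm ?exprn_gt0// ler_pdivlMr// mulrC => h.
by exists k.
Qed.

(** A slab of width [w] has measure of order at most [w] to the power [1 / D], so geometric widths
    give geometric measures, with the slower ratio [r] for which [g <= r ^+ D]. *)
Lemma geometric_slab d (mu : probability (d.-tuple R) R) (A g : R) : (0 < d)%N ->
  is_uniform_sphere_measure mu -> 0 < A -> 0 < g < 1 ->
  exists B r, [/\ 0 < B, 0 < r < 1 & forall k y, sphere d y ->
    (mu (slab y (A * g ^+ k)) <= (B * r ^+ k)%:E)%E].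
Proof.
move=> d0 mu_unif A0 g01.
have [L [D [L1 D1 slabL]]] := slab_measure_le d0 mu_unif.
have [r /andP[r0 r1] gr] := geometric_root D1 g01.
move: g01 => /andP[g0 g1].
have d1 : 1 <= d%:R :> R by rewrite ler1n.
pose s := 1 + L * A.
have LA0 : 0 < L * A by rewrite mulr_gt0// (lt_le_trans ltr01).
have s1 : 1 < s by rewrite ltrDl.
have s0 : 0 < s by exact: lt_trans ltr01 s1.
exists (2 * d%:R * s), r; split; [by rewrite !mulr_gt0// (lt_le_trans ltr01)|by rewrite r0|].
move=> k y yS.
have rk0 : 0 < r ^+ k by rewrite exprn_gt0.
(* The number of slabs is of order [r ^- k], as the width [A * g ^+ k] permits; [s] is at least 1
   and at least [L * A], so [s ^+ D] absorbs the constants. *)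
pose N := Num.trunc ((r ^+ k * s)^-1).
have q0 : 0 < r ^+ k * s by rewrite mulr_gt0.
have /andP[Nle Ngt] : N%:R <= (r ^+ k * s)^-1 < N.+1%:R.
  by apply: truncn_itv; rewrite invr_ge0 ltW.
have [N0|N0] := posnP N; last first.
  have N1 : 1 <= N%:R :> R by rewrite ler1n.
  have N_gt0 : 0 < N%:R :> R by rewrite ltr0n.
  apply: (le_trans (slabL N _ _ N0 yS _)).
    have LN0 : 0 < L * N%:R ^+ D by rewrite mulr_gt0 ?exprn_gt0// (lt_le_trans ltr01).
    rewrite -[leRHS]mul1r ler_pdivlMr//.
    apply: (@le_trans _ _ ((N%:R * (r ^+ k * s)) ^+ D)); last first.
      apply: exprn_ile1; first by rewrite mulr_ge0// ltW.
      by rewrite -ler_pdivlMr// mul1r.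
    have -> : (N%:R * (r ^+ k * s)) ^+ D = N%:R ^+ D * ((r ^+ D) ^+ k * s ^+ D).
      by rewrite !exprMn -!exprM (mulnC k D).
    have -> : A * g ^+ k * (L * N%:R ^+ D) = N%:R ^+ D * (g ^+ k * (L * A)) by ring.
    rewrite ler_wpM2l ?exprn_ge0// ler_pM ?exprn_ge0 ?(ltW g0) ?(ltW LA0)//.
      by apply: lerXn2r; rewrite ?nnegrE ?exprn_ge0// ltW.
    apply: (@le_trans _ _ s); first by rewrite /s; lra.
    by rewrite ler_eXnr// ltW.
  rewrite lee_fin ler_pdivrMr//.
  have -> : 2 * d%:R * s * r ^+ k * N%:R = d%:R * (2 * N%:R * (r ^+ k * s)) by ring.
  rewrite ler_peMr//.
  have : 1 < N.+1%:R * (r ^+ k * s) by rewrite -ltr_pdivrMr// mul1r.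
  move=> /ltW /le_trans; apply; rewrite ler_wpM2r ?(ltW q0)// -natr1; lra.
(* If [N] is 0 the claimed bound exceeds 1 and holds for any probability. *)
have rs1 : 1 <= r ^+ k * s.
  by move: Ngt; rewrite N0 invf_lt1// => /ltW.
apply: le_trans (probability_le1 _ (measurable_slab _ _)) _; rewrite lee_fin.
have -> : 2 * d%:R * s * r ^+ k = (2 * d%:R) * (r ^+ k * s) by ring.
by rewrite mulr_ege1// mulr_ege1// ler1n.
Qed.

End Geometric.

(** * Averaging by stochastic matrices *)

Section Averaging.
Context {R : realType}.

Lemma pos_lower_bound (I : finType) (f : I -> R) :
  exists2 m, 0 < m & forall i, 0 < f i -> m <= f i.
Proof.
(* The minimum over the positive values only; 1 is the value when there are none. *)
exists (\big[Num.min/1]_(i | 0 < f i) f i).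
  by elim/big_ind: _ => // a b a0 b0; rewrite lt_min a0 b0.
by move=> i fi; rewrite (bigD1 i)//= ge_min lexx.
Qed.

Section Weights.
Context {n : nat}.
Variables (A : 'M[R]_n) (alpha : R) (w : nat -> 'I_n -> 'I_n -> R).
Hypothesis alpha_ge0 : 0 <= alpha.
Hypothesis A_ge0 : forall i j, 0 <= A i j.
Hypothesis w_ge : forall t i j, alpha * A i j <= w t i j.
Hypothesis w_sum1 : forall t i, \sum_j w t i j = 1.

Let w_ge0 t i j : 0 <= w t i j.
Proof. by apply: le_trans (w_ge t i j); rewrite mulr_ge0. Qed.

Lemma exprmx_ge0 t i j : 0 <= (A ^+ t) i j.
Proof.
elim: t i j => [|t IH] i j; first by rewrite expr0 mxE ler0n.
by rewrite exprS mxE; apply: sumr_ge0 => k _; rewrite mulr_ge0.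
Qed.

(** The initial deficit of [j] below [hi] reaches [i] along the walks of length [t] from [i] to [j]:
    their total weight is at least [alpha ^+ t * (A ^+ t) i j]. *)
Lemma averaging_le (f : nat -> 'I_n -> R) hi t j :
  (forall t i, f t.+1 i = \sum_j w t i j * f t j) ->
  (forall i, f 0%N i <= hi) ->
  forall i, f t i <= hi - alpha ^+ t * (A ^+ t) i j * (hi - f 0%N j).
Proof.
move=> fS f_hi; elim: t => [|t IH] i.
  rewrite !expr0 mxE mul1r; have [->|ij] := eqVneq i j; first by rewrite mul1r; lra.
  by rewrite mul0r subr0.
have h0 : 0 <= hi - f 0%N j by rewrite subr_ge0.
rewrite fS; apply: (@le_trans _ _ (\sum_k w t i k *
    (hi - alpha ^+ t * (A ^+ t) k j * (hi - f 0%N j)))).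
  by apply: ler_sum => k _; rewrite ler_wpM2l.
under eq_bigr do rewrite mulrBr.
rewrite big_split/= -mulr_suml w_sum1 mul1r lerD2l sumrN lerN2.
rewrite exprS [A ^+ _]exprS mxE mulr_sumr mulr_suml; apply: ler_sum => k _.
have -> : alpha * alpha ^+ t * (A i k * (A ^+ t) k j) * (hi - f 0%N j) =
  alpha * A i k * (alpha ^+ t * (A ^+ t) k j * (hi - f 0%N j)) by ring.
by rewrite ler_wpM2r// !mulr_ge0// ?exprn_ge0// exprmx_ge0.
Qed.

Lemma averaging_range (f : nat -> 'I_n -> R) lo hi t :
  (forall t i, f t.+1 i = \sum_j w t i j * f t j) ->
  (forall i, lo <= f 0%N i <= hi) -> forall i, lo <= f t i <= hi.
Proof.
move=> fS f0; elim: t => [//|t IH] i; rewrite fS.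
rewrite -[lo]mul1r -[hi]mul1r -(w_sum1 t i) !mulr_suml.
by rewrite !ler_sum// => j _; rewrite ler_wpM2l//; have /andP[] := IH j.
Qed.

(** One fixed index [j] starts in the lower or in the upper half of the range. After [n] steps it
    has pulled every value away from the opposite end by a fixed fraction of the range. *)
Lemma averaging_contraction (f : nat -> 'I_n -> R) a lo hi :
  (forall t i, f t.+1 i = \sum_j w t i j * f t j) ->
  (forall i j, a <= (A ^+ n) i j) -> 0 <= a ->
  (forall i, lo <= f 0%N i <= hi) ->
  exists lo' hi', hi' - lo' <= (1 - alpha ^+ n * a / 2) * (hi - lo) /\
    forall i, lo' <= f n i <= hi'.
Proof.
move=> fS aA a0 f0.
have R0 := averaging_range n fS f0.
have [n0|n_gt0] := posnP n.
  (* Without indices only the first inequality matters; the minimum secures it whatever the sign of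
     [hi - lo]. *)
  exists 0, (Num.min 0 ((1 - alpha ^+ n * a / 2) * (hi - lo))).
  split; first by rewrite subr0 ge_min lexx orbT.
  by move=> i; have := ltn_ord i; rewrite {2}n0.
pose j := Ordinal n_gt0.
have al0 : 0 <= alpha ^+ n by rewrite exprn_ge0.
have lohi : lo <= hi by have /andP[/le_trans h /h] := f0 j.
have ratio i x : (hi - lo) / 2 <= x ->
    alpha ^+ n * a / 2 * (hi - lo) <= alpha ^+ n * (A ^+ n) i j * x.
  move=> hx; have -> : alpha ^+ n * a / 2 * (hi - lo) =
    alpha ^+ n * (a * ((hi - lo) / 2)) by field.
  by rewrite -mulrA ler_wpM2l// ler_pM// divr_ge0// subr_ge0.
have [fj|fj] := leP (f 0%N j) ((lo + hi) / 2).
  exists lo, (hi - alpha ^+ n * a / 2 * (hi - lo)); split; first by lra.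
  move=> i; have /andP[-> _] := R0 i => /=.
  have f_hi k : f 0%N k <= hi by have /andP[] := f0 k.
  apply: le_trans (averaging_le n j fS f_hi i) _.
  rewrite lerD2l lerN2; apply: ratio; lra.
(* The upper half is reduced to the lower one by applying [averaging_le] to [- f]. *)
exists (lo + alpha ^+ n * a / 2 * (hi - lo)), hi; split; first by lra.
move=> i; have /andP[_ ->] := R0 i; rewrite andbT.
have fS' t k : - f t.+1 k = \sum_j w t k j * - f t j.
  by rewrite fS -sumrN; apply: eq_bigr => l _; rewrite mulrN.
have f_lo k : - f 0%N k <= - lo by rewrite lerN2; have /andP[] := f0 k.
have := @averaging_le (fun t i => - f t i) (- lo) n j fS' f_lo i.
rewrite -(lerN2 (f n i)) => /le_trans; apply; rewrite opprD lerD2l lerN2.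
by apply: ratio; lra.
Qed.

End Weights.

(** Each full block of [n] steps contracts the range, and within the last incomplete block the range
    cannot grow. *)
Lemma averaging_iter n (A : 'M[R]_n) alpha (w : nat -> 'I_n -> 'I_n -> R)
    (f : nat -> 'I_n -> R) a g lo hi :
  0 <= alpha -> (forall i j, 0 <= A i j) ->
  (forall t i j, alpha * A i j <= w t i j) -> (forall t i, \sum_j w t i j = 1) ->
  (forall t i, f t.+1 i = \sum_j w t i j * f t j) ->
  (forall i j, a <= (A ^+ n) i j) -> 0 <= a -> 0 <= g -> 1 - alpha ^+ n * a / 2 <= g ->
  (forall i, lo <= f 0%N i <= hi) ->
  forall k i j, f k i - f k j <= g ^+ (k %/ n) * (hi - lo).
Proof.
move=> al0 A0 wA w1 fS aA a0 g0 gle f0.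
have [n0|n_gt0] := posnP n.
  by move=> k i; have := ltn_ord i; rewrite {2}n0.
have range q : exists lo' hi', hi' - lo' <= g ^+ q * (hi - lo) /\
    forall i, lo' <= f (q * n)%N i <= hi'.
  elim: q => [|q [lo' [hi' [hl fq]]]]; first by exists lo, hi; rewrite expr0 mul1r mul0n.
  have [] := @averaging_contraction n A alpha (fun t => w (q * n + t)%N) al0 A0 _ _
    (fun t => f (q * n + t)%N) a lo' hi' _ aA a0 _ => //.
  - by move=> t i; rewrite addnS fS.
  - by rewrite addn0.
  move=> lo2 [hi2 [hl2 f2]]; exists lo2, hi2; rewrite mulSn addnC; split=> //.
  apply: le_trans hl2 _; rewrite exprS -[leRHS]mulrA.
  have lohi : 0 <= hi' - lo'.
    by rewrite subr_ge0; have /andP[/le_trans h /h] := fq (Ordinal n_gt0).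
  by apply: le_trans (ler_wpM2r lohi gle) _; rewrite ler_wpM2l.
move=> k i j; have [lo' [hi' [hl fq]]] := range (k %/ n)%N.
have := @averaging_range n A alpha (fun t => w (k %/ n * n + t)%N) al0 A0 _ _
  (fun t => f (k %/ n * n + t)%N) lo' hi' (k %% n)%N.
move=> /(_ _ _ _ _)/wrap[||||h] //.
- by move=> t l; rewrite addnS fS.
- by rewrite addn0.
move: h; rewrite -divn_eq => h.
have /andP[h1 h2] := h i; have /andP[h3 h4] := h j.
by apply: le_trans hl; lra.
Qed.

End Averaging.

(** * Consensus dynamics *)

Section Consensus.
Context {R : realType} {n d : nat}.
Variable eta : 'I_n -> 'I_n -> R.
Hypothesis eta_ge0 : forall i j, 0 <= eta i j.

Definition mixing i j : R := (i == j)%:R + eta i j.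

(** The unnormalized party update when all agents are on the same side of the hyperplane, so that no
    minus sign occurs. *)
Definition consensus_unnorm (Y : 'I_n -> d.-tuple R) i : d.-tuple R :=
  [tuple \sum_j mixing i j * tnth (Y j) k | k < d].

Definition consensus_step (Y : 'I_n -> d.-tuple R) : 'I_n -> d.-tuple R :=
  fun i => proj_sphere (consensus_unnorm Y i).

Lemma mixing_ge0 i j : 0 <= mixing i j.
Proof. by rewrite addr_ge0. Qed.

Lemma mixing_ge_eta i j : eta i j <= mixing i j.
Proof. by rewrite lerDr. Qed.

Lemma sum_mixing_ge1 i : 1 <= \sum_j mixing i j.
Proof.
rewrite (bigD1 i)//= /mixing eqxx -addrA lerDl addr_ge0//.
by apply: sumr_ge0 => j _; exact: mixing_ge0.
Qed.

Lemma dotv_consensus_unnorm Y i u :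
  dotv (consensus_unnorm Y i) u = \sum_j mixing i j * dotv (Y j) u.
Proof. exact: dotv_tuple_sum. Qed.

Lemma consensus_unnorm_gt0 Y u i :
  (forall j, 0 < dotv (Y j) u) -> 0 < dotv (consensus_unnorm Y i) u.
Proof.
move=> Yu; rewrite dotv_consensus_unnorm (bigD1 i)//= ltr_pwDl//.
  by rewrite mulr_gt0// /mixing eqxx ltr_pwDl.
by apply: sumr_ge0 => j _; rewrite mulr_ge0 ?mixing_ge0// ltW.
Qed.

Lemma consensus_unnorm_norm_gt0 Y u i :
  (forall j, 0 < dotv (Y j) u) -> 0 < normv (consensus_unnorm Y i).
Proof.
move=> Yu; rewrite normv_gt0; apply: contraTneq (consensus_unnorm_gt0 i Yu) => ->.
by rewrite /dotv big1 ?ltxx// => k _; rewrite tnth_mktuple mul0r.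
Qed.

Lemma consensus_step_sphere Y u i :
  (forall j, 0 < dotv (Y j) u) -> sphere d (consensus_step Y i).
Proof.
by move=> Yu; apply: proj_sphereP; rewrite -normv_gt0; exact: consensus_unnorm_norm_gt0 Yu.
Qed.

Lemma consensus_step_gt0 Y u i :
  (forall j, 0 < dotv (Y j) u) -> 0 < dotv (consensus_step Y i) u.
Proof.
move=> Yu; rewrite dotv_proj mulr_gt0 ?consensus_unnorm_gt0// invr_gt0.
exact: consensus_unnorm_norm_gt0 Yu.
Qed.

Lemma consensus_iter_gt0 Y u k : (forall j, 0 < dotv (Y j) u) ->
  forall i, 0 < dotv (iter k consensus_step Y i) u.
Proof. by move=> Yu; elim: k => //= k IH i; exact: consensus_step_gt0. Qed.

Lemma normv_consensus_le Y i : (forall j, sphere d (Y j)) ->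
  normv (consensus_unnorm Y i) <= \sum_j mixing i j.
Proof.
move=> YS; have s0 : 0 <= \sum_j mixing i j by apply: le_trans (sum_mixing_ge1 i).
rewrite -(ger0_norm s0) -sqrtr_sqr ler_sqrt ?sqr_ge0//.
rewrite dotv_consensus_unnorm expr2 mulr_suml; apply: ler_sum => j _.
rewrite ler_wpM2l ?mixing_ge0// dotvC dotv_consensus_unnorm.
by apply: ler_sum => l _; rewrite ler_piMr ?mixing_ge0// dotv_sphere_le1.
Qed.

(** Before normalization the inner product with [v] is at least [c] times the total weight, and the
    norm is at most the total weight. *)
Lemma consensus_step_margin Y v c i : (forall j, sphere d (Y j)) -> 0 < c ->
  (forall j, c <= dotv (Y j) v) -> c <= dotv (consensus_step Y i) v.
Proof.
move=> YS c0 Yv; have Yv0 j : 0 < dotv (Y j) v by exact: lt_le_trans (Yv j).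
rewrite dotv_proj mulrC ler_pdivlMr; last exact: consensus_unnorm_norm_gt0 Yv0.
apply: (@le_trans _ _ (c * \sum_j mixing i j)).
  by rewrite ler_wpM2l ?(ltW c0)// normv_consensus_le.
rewrite dotv_consensus_unnorm mulr_sumr; apply: ler_sum => j _.
by rewrite mulrC ler_wpM2l// mixing_ge0.
Qed.

Lemma consensus_iter_sphere_margin Y v c k : (forall j, sphere d (Y j)) -> 0 < c ->
  (forall j, c <= dotv (Y j) v) ->
  forall i, sphere d (iter k consensus_step Y i) /\ c <= dotv (iter k consensus_step Y i) v.
Proof.
move=> YS c0 Yv; elim: k => [i//|k IH i] /=.
split; last by apply: consensus_step_margin => // j; have [] := IH j.
apply: (@consensus_step_sphere _ v) => j.
by have [_] := IH j; exact: lt_le_trans.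
Qed.

(** Transfers closeness from the central projections [x / dotv x v] and [y / dotv y v] back to the
    sphere. The squared norms of these projections are [a^-1 ^+ 2] and [b^-1 ^+ 2], so the scaling
    factors are close as well. *)
Lemma sphere_coord_diff_le (x y v : d.-tuple R) c th :
  sphere d x -> sphere d y -> sphere d v -> 0 < c ->
  c <= dotv x v -> c <= dotv y v ->
  (forall l, `|tnth x l / dotv x v - tnth y l / dotv y v| <= th) ->
  forall l, `|tnth x l - tnth y l| <= th * (1 + d%:R / c).
Proof.
move=> xS yS vS c0 cx cy xy l.
have ax0 : 0 < dotv x v by exact: lt_le_trans cx.
have ay0 : 0 < dotv y v by exact: lt_le_trans cy.
have ax1 := dotv_sphere_le1 xS vS.
have ay1 := dotv_sphere_le1 yS vS.
have th0 : 0 <= th by apply: le_trans (xy l).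
set a := dotv x v in xy cx ax0 ax1; set b := dotv y v in xy cy ay0 ay1.
have inv_le (z : d.-tuple R) e k : sphere d z -> 0 < e -> c <= e -> `|tnth z k / e| <= c^-1.
  move=> zS e0 ce; rewrite normrM normfV (gtr0_norm e0).
  rewrite -[leRHS]mul1r ler_pM ?invr_ge0 ?(ltW e0) ?sphere_coord_le1//.
  by rewrite lef_pV2// posrE.
have inv_diff : `|a^-1 - b^-1| <= d%:R * th / c.
  have sum_sq (z : d.-tuple R) e : sphere d z -> \sum_(k < d) (tnth z k / e) ^+ 2 = (e^-1) ^+ 2.
    move=> /sphereP zS; rewrite -[RHS]mul1r -zS /dotv mulr_suml; apply: eq_bigr => k _.
    by rewrite exprMn expr2.
  have ineq : `|(a^-1) ^+ 2 - (b^-1) ^+ 2| <= 2 * (d%:R * th / c).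
    have -> : 2 * (d%:R * th / c) = d%:R * (th * (2 / c)) by ring.
    rewrite -(sum_sq x a xS) -(sum_sq y b yS) -sumrB.
    apply: le_trans (ler_norm_sum _ _ _) _.
    rewrite mulr_natl -[X in _ *+ X]card_ord -sumr_const; apply: ler_sum => k _.
    rewrite subr_sqr normrM ler_pM// (le_trans (ler_normD _ _))//.
    have := inv_le x a k xS ax0 cx; have := inv_le y b k yS ay0 cy; lra.
  (* Both inverses are at least 1, so the difference of their squares is at least twice their
     difference. *)
  have ia : 1 <= a^-1 by rewrite invf_ge1.
  have ib : 1 <= b^-1 by rewrite invf_ge1.
  move: ineq ia ib; move: a^-1 b^-1 => p q.
  rewrite subr_sqr normrM => ht ip iq; move: ht; rewrite [`|p + q|]ger0_norm; last by lra.
  have := normr_ge0 (p - q); move: `|p - q| => t t0 ht.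
  have : t * 2 <= t * (p + q) by rewrite ler_wpM2l//; lra.
  by move=> /le_trans/(_ ht); move: (d%:R * th / c) => *; lra.
have -> : tnth x l - tnth y l =
    a * (tnth x l / a - tnth y l / b) + a * (tnth y l * (b^-1 - a^-1)).
  by field; rewrite !gt_eqF.
apply: le_trans (ler_normD _ _) _; rewrite !normrM (gtr0_norm ax0) mulrDr mulr1.
rewrite lerD//.
  by rewrite -[leRHS]mul1r ler_pM// ltW.
rewrite -[leRHS]mul1r ler_pM// ?mulr_ge0 ?(ltW ax0)//.
rewrite -[leRHS]mul1r ler_pM// ?sphere_coord_le1// distrC.
by apply: le_trans inv_diff _; rewrite [d%:R * th]mulrC mulrA.
Qed.

Hypothesis irred : forall i j, 0 < (adj_matrix eta ^+ n) i j.

(** In the chart [x / dotv x v] the normalization cancels, and the consensus step becomes averaging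
    with a row-stochastic matrix. The margin [c] bounds its relevant entries from below, so the rate
    is uniform in [Y] and [v]. *)
Lemma consensus_contracts c : (0 < n)%N -> 0 < c ->
  exists A b, [/\ 0 < A, 0 < b < 1 &
    forall (Y : 'I_n -> d.-tuple R) v, (forall j, sphere d (Y j)) -> sphere d v ->
      (forall j, c <= dotv (Y j) v) ->
      forall k i j l, `|tnth (iter k consensus_step Y i) l
                        - tnth (iter k consensus_step Y j) l| <= A * b ^+ k].
Proof.
move=> n0 c0.
have [m m0 eta_m] := pos_lower_bound (fun p : 'I_n * 'I_n => eta p.1 p.2).
have [a a0 adj_a] := pos_lower_bound (fun p : 'I_n * 'I_n => (adj_matrix eta ^+ n) p.1 p.2).
pose M := \sum_i \sum_j mixing i j.
have M_ge i : \sum_j mixing i j <= M.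
  rewrite /M [leRHS](bigD1 i)//= lerDl; apply: sumr_ge0 => k _.
  by apply: sumr_ge0 => j _; exact: mixing_ge0.
have M0 : 0 < M.
  by apply: lt_le_trans (M_ge (Ordinal n0)); exact: lt_le_trans ltr01 (sum_mixing_ge1 _).
(* The smallest positive influence times the smallest inner product with [v], over a bound for the
   row sums [S t p]. *)
pose alpha := m * c / M.
have alpha0 : 0 < alpha by rewrite divr_gt0// mulr_gt0.
(* The maximum with one half only keeps the rate positive. *)
pose g := Num.max 2^-1 (1 - alpha ^+ n * a / 2).
have g01 : 0 < g < 1.
  rewrite lt_max invr_gt0 ltr0n/= gt_max.
  have : 0 < alpha ^+ n * a / 2 by rewrite divr_gt0// mulr_gt0// exprn_gt0.
  by move=> h; apply/andP; split; lra.
have [B [b [B0 b01 gB]]] := geometric_divn n0 g01.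
(* The length of an interval containing all chart coordinates at the start. *)
pose W := c^-1 - - c^-1.
have W0 : 0 < W by rewrite /W opprK addr_gt0// invr_gt0.
have D0 : 0 < 1 + d%:R / c by rewrite ltr_pwDl// divr_ge0// ltW.
exists (B * W * (1 + d%:R / c)), b; split => //; first by rewrite !mulr_gt0.
move=> Y v YS vS Yv k i j l.
pose Yk t := iter t consensus_step Y.
have YkS t p : sphere d (Yk t p) by have [] := consensus_iter_sphere_margin t YS c0 Yv p.
have Ykc t p : c <= dotv (Yk t p) v.
  by have [] := consensus_iter_sphere_margin t YS c0 Yv p.
have Yk0 t p : 0 < dotv (Yk t p) v by exact: lt_le_trans (Ykc t p).
pose S t p := \sum_q mixing p q * dotv (Yk t q) v.
have S0 t p : 0 < S t p.
  by have := consensus_unnorm_gt0 p (Yk0 t); rewrite dotv_consensus_unnorm.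
pose w t p q := mixing p q * dotv (Yk t q) v / S t p.
have w_sum t p : \sum_q w t p q = 1 by rewrite /w -mulr_suml; exact: divff (lt0r_neq0 (S0 t p)).
have w_ge t p q : alpha * (adj_matrix eta) p q <= w t p q.
  rewrite mxE; case: ifP => [eta_pos|_]; last first.
    by rewrite mulr0 divr_ge0 ?mulr_ge0 ?mixing_ge0 ?(ltW (Yk0 _ _)) ?(ltW (S0 _ _)).
  rewrite mulr1 /alpha /w ler_pM ?invr_ge0 ?mulr_ge0 ?(ltW m0) ?(ltW c0) ?(ltW M0)//.
    rewrite ler_pM ?(ltW m0) ?(ltW c0)//.
    by apply: le_trans (mixing_ge_eta p q); exact: (eta_m (p, q)).
  rewrite lef_pV2 ?posrE// (le_trans _ (M_ge p))//; apply: ler_sum => r _.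
  by rewrite ler_piMr ?mixing_ge0// dotv_sphere_le1.
have adj0 p q : 0 <= adj_matrix eta p q by rewrite mxE; case: ifP.
pose f r t p := tnth (Yk t p) r / dotv (Yk t p) v.
have f_le r t p q : `|f r t p - f r t q| <= g ^+ (t %/ n) * W.
  have fS t' p' : f r t'.+1 p' = \sum_q w t' p' q * f r t' q.
    rewrite /f {1 2}/Yk /= tnth_mktuple dotv_proj -mulf_div.
    rewrite divff ?mul1r; last first.
      by rewrite invr_eq0 gt_eqF// (consensus_unnorm_norm_gt0 _ (Yk0 t')).
    rewrite dotv_consensus_unnorm tnth_mktuple mulr_suml; apply: eq_bigr => s _.
    rewrite /w -/(Yk t') -/(S t' p'); field.
    by rewrite !gt_eqF// ?S0 ?Yk0.
  have f0 p' : - c^-1 <= f r 0%N p' <= c^-1.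
    rewrite -ler_norml /f normrM normfV (gtr0_norm (Yk0 _ _)).
    rewrite -[leRHS]mul1r ler_pM ?invr_ge0 ?(ltW (Yk0 _ _)) ?sphere_coord_le1//.
    by rewrite lef_pV2 ?posrE.
  have osc p' q' := averaging_iter (ltW alpha0) adj0 w_ge w_sum fS
    (fun p q => adj_a (p, q) (irred p q)) (ltW a0) (ltW (andP g01).1)
    (_ : 1 - alpha ^+ n * a / 2 <= g) f0 t p' q'.
  by rewrite ler_norml -opprB lerNl !opprK ?opprB !osc// le_max lexx orbT.
apply: le_trans (sphere_coord_diff_le (YkS k i) (YkS k j) vS c0 (Ykc k i) (Ykc k j)
  (fun r => f_le r k i j) l) _.
have -> : B * W * (1 + d%:R / c) * b ^+ k = B * b ^+ k * W * (1 + d%:R / c) by ring.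
by rewrite !ler_wpM2r// ?gB// ltW.
Qed.

End Consensus.

(** * Processes driven by finitely many patterns *)

Section FinitePartition.
Context {R : realType} {dT : measure_display} {T : measurableType dT}.

Lemma measure_fin_partition (I : finType) (mu : {measure set T -> \bar R})
    (f : T -> I) (E : set T) :
  (forall a, measurable (E `&` [set w | f w = a])) ->
  mu E = (\sum_a mu (E `&` [set w | f w = a]))%E.
Proof.
move=> mE.
have -> : (\sum_a mu (E `&` [set w | f w = a]) =
    \sum_(a \in [set: I]) mu (E `&` [set w | f w = a]))%E.
  have -> : [set: I] = [set a | a \in index_enum I].
    by apply/seteqP; split=> a //= _; exact: mem_index_enum.
  by rewrite -fsbig_seq// index_enum_uniq.
rewrite -measure_fin_bigcup//; last 2 first.
- exact: finite_finset.
- by move=> a b _ _ [w [[_ /= <-] [_ /= <-]]].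
congr (mu _); apply/seteqP; split=> [w Ew|w [a _ []]//].
by exists (f w).
Qed.

Lemma measurable_fin_partition (I : finType) (f : T -> I) (E : set T) :
  (forall a, measurable (E `&` [set w | f w = a])) -> measurable E.
Proof.
move=> mE; rewrite (_ : E = \bigcup_(a in [set: I]) (E `&` [set w | f w = a])).
  exact: fin_bigcup_measurable.
apply/seteqP; split=> [w Ew|w [a _ []]//].
by exists (f w).
Qed.

End FinitePartition.

Section FiniteBranching.
Context {R : realType} {dT dU : measure_display}.
Context {T : measurableType dT} {U : measurableType dU} {P : probability T R}.
Variables (xi : nat -> T -> U) (nu : set U -> R).
Hypothesis xi_meas : forall t, measurable_fun setT (xi t).
Hypothesis xi_indep : mutually_independent P xi.
Hypothesis xi_law : forall t B, measurable B -> P (xi t @^-1` B) = (nu B)%:E.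
Context {S : Type} {A : finType}.
Variables (pat : S -> U -> A) (next : S -> A -> S).
Hypothesis pat_meas : forall s a, measurable [set u | pat s u = a].

(** [m] is the index of the first input. Recursion on the first step lets inductions split on the
    first pattern; [run_recr] recovers the last step. *)
Fixpoint run (s : S) (m t : nat) (w : T) : S :=
  if t is t'.+1 then run (next s (pat s (xi m w))) m.+1 t' w else s.

(** The one-step transition operator of the chain of states. *)
Definition branch_mean (f : S -> R) (s : S) : R :=
  \sum_a nu [set u | pat s u = a] * f (next s a).

Lemma run_recr s m t w :
  run s m t.+1 w = next (run s m t w) (pat (run s m t w) (xi (m + t)%N w)).
Proof.
elim: t s m => [|t IH] s m; first by rewrite addn0.
by rewrite addnS -addSn; exact: IH.
Qed.

Lemma law_ge0 B : measurable B -> 0 <= nu B.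
Proof. by move=> mB; rewrite -lee_fin -(xi_law 0%N mB). Qed.

Lemma measurable_xi_preimage t B : measurable B -> measurable (xi t @^-1` B).
Proof. by move=> mB; rewrite -[X in measurable X]setTI; exact: xi_meas. Qed.

(** [S] carries no sigma-algebra and [F] is arbitrary: after [t] steps only finitely many states are
    reachable, each through measurable pattern events. *)
Lemma measurable_run s m t (F : set S) : measurable [set w | F (run s m t w)].
Proof.
elim: t s m => [|t IH] s m /=.
  have [Fs|Fs] := pselect (F s).
    by rewrite (_ : [set _ | _] = setT)//; apply/seteqP; split.
  by rewrite (_ : [set _ | _] = set0)//; apply/seteqP; split.
apply: (@measurable_fin_partition _ _ _ (fun w => pat s (xi m w))) => a.
rewrite (_ : _ `&` _ =
    [set w | F (run (next s a) m.+1 t w)] `&` xi m @^-1` [set u | pat s u = a]).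
  by apply: measurableI => //; exact: measurable_xi_preimage.
by apply/seteqP; split => w /= [+ h]; rewrite h.
Qed.

(** The constraints [B] on the inputs before time [m] are carried along so that each pattern chosen
    by the run becomes one more constraint. Independence is then used once, at the leaves, and no
    conditional expectation is involved. *)
Lemma run_cylinder (B : nat -> set U) s m t (F : set S) :
  (forall u, measurable (B u)) ->
  P ((\bigcap_(u in [set u | (u < m)%N]) (xi u @^-1` B u)) `&` [set w | F (run s m t w)])
  = ((\prod_(u <- iota 0 m) nu (B u)) *
     iter t branch_mean (fun s => `[< F s >]%:R) s)%:E.
Proof.
elim: t s m B => [|t IH] s m B mB.
  have base : P (\bigcap_(u in [set u | (u < m)%N]) (xi u @^-1` B u)) =
      (\prod_(u <- iota 0 m) nu (B u))%:E.
    have -> : [set u | (u < m)%N] = [set` iota 0 m].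
      by apply/seteqP; split=> u; rewrite /= mem_iota.
    rewrite xi_indep ?iota_uniq// -prodEFin; apply: eq_bigr => u _; exact: xi_law.
  rewrite /=; case: asboolP => Fs.
    rewrite mulr1 -base; congr (P _).
    by apply/seteqP; split=> [w []//|w].
  rewrite mulr0 (_ : _ `&` _ = set0) ?measure0//.
  by apply/seteqP; split=> [w []|].
set C := \bigcap_(u in _) _.
have mC : measurable C.
  by apply: bigcap_measurableType => u _; exact: measurable_xi_preimage.
(* The event that the first pattern is [a] joins the prefix as the constraint at time [m]. *)
pose B' a u := if u == m then [set v | pat s v = a] else B u.
have mB' a u : measurable (B' a u) by rewrite /B'; case: ifP.
have split_a a : (C `&` [set w | F (run s m t.+1 w)]) `&` [set w | pat s (xi m w) = a] =
  (\bigcap_(u in [set u | (u < m.+1)%N]) (xi u @^-1` B' a u)) `&`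
     [set w | F (run (next s a) m.+1 t w)].
  apply/seteqP; split => w /=.
    move=> [[Cw Fw] h]; rewrite h in Fw; split=> // u /=.
    rewrite ltnS leq_eqVlt /B'; case: eqP => [->//|_ /=]; exact: Cw.
  move=> [Cw Fw].
  have h : pat s (xi m w) = a by have := Cw m (ltnSn m); rewrite /B' eqxx.
  rewrite h; split=> //; split=> // u /= um.
  by have := Cw u (ltnW um); rewrite /B' ltn_eqF.
have m_a a : measurable
    ((C `&` [set w | F (run s m t.+1 w)]) `&` [set w | pat s (xi m w) = a]).
  apply: measurableI; last exact: (measurable_xi_preimage m (pat_meas s a)).
  by apply: measurableI => //; exact: measurable_run.
rewrite (measure_fin_partition _ m_a) iterS {2}/branch_mean mulr_sumr -sumEFin.
apply: eq_bigr => a _; rewrite split_a; apply: etrans (IH _ _ _ (mB' a)) _; congr (_%:E).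
rewrite -addn1 iotaD big_cat/= big_seq1 add0n mulrA; congr (_ * _ * _).
  rewrite !big_seq; apply: eq_bigr => u; rewrite mem_iota add0n /B' => /andP[_ um].
  by rewrite ltn_eqF.
by rewrite /B' eqxx.
Qed.

Lemma run_law s t (F : set S) :
  P [set w | F (run s 0 t w)] = (iter t branch_mean (fun s => `[< F s >]%:R) s)%:E.
Proof.
have := @run_cylinder (fun=> setT) s 0 t F (fun=> measurableT).
rewrite big_nil mul1r => <-; congr (P _).
by apply/seteqP; split=> [w Fw|w []//]; split.
Qed.

(** Markov's inequality: on the invariant set, [c] times the indicator of [F] is below [V], and the
    transition operator does not increase [V]. *)
Lemma run_supermartingale (I F : set S) (V : S -> R) c s t : 0 < c ->
  (forall s a, I s -> I (next s a)) -> (forall s, I s -> 0 <= V s) ->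
  (forall s, I s -> branch_mean V s <= V s) ->
  (forall s, I s -> F s -> c <= V s) -> I s ->
  (P [set w | F (run s 0 t w)] <= (V s / c)%:E)%E.
Proof.
move=> c0 Inext V0 Vsuper FV Is; rewrite run_law lee_fin ler_pdivlMr//.
elim: t s Is => [|t IH] s Is.
  by rewrite /=; case: asboolP => Fs; [rewrite mul1r FV|rewrite mul0r V0].
apply: le_trans (Vsuper _ Is); rewrite iterS {1}/branch_mean mulr_suml.
apply: ler_sum => a _; rewrite -mulrA ler_wpM2l ?law_ge0//.
by apply: IH; exact: Inext.
Qed.

End FiniteBranching.

(** * Sign patterns and orientations *)

Section SignPatterns.
Context {R : realType} {n d : nat}.
Implicit Types (X Y : 'I_n -> d.-tuple R) (s : {ffun 'I_n -> bool}).
Implicit Type a : {ffun 'I_n * 'I_n -> bool}.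

Lemma sg_eq (e u v : R) : e < `|u| -> `|v - u| <= e -> Num.sg v = Num.sg u.
Proof.
move=> eu vu; have e0 : 0 <= e by apply: le_trans vu.
move/ler_normlP: vu => [h1 h2].
have [u0|u0] := ltrP u 0.
  by move: eu; rewrite ltr0_norm// => eu; rewrite !ltr0_sg//; lra.
by move: eu; rewrite ger0_norm// => eu; rewrite !gtr0_sg//; lra.
Qed.

(** The update sees [x] only through this relation, which takes finitely many values. *)
Definition same_side X (x : d.-tuple R) : {ffun 'I_n * 'I_n -> bool} :=
  [ffun p => Num.sg (dotv (X p.1) x) == Num.sg (dotv (X p.2) x)].

Lemma measurable_sg_set (y : d.-tuple R) e : measurable [set x | Num.sg (dotv y x) = e].
Proof.
have half (B : set R) : measurable B -> measurable [set x | B (dotv y x)].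
  move=> mB; rewrite (_ : mkset _ = [set x | B (dotv x y)]); last first.
    by apply/seteqP; split=> x; rewrite /= dotvC.
  exact: measurable_dotv_set.
have sgn_cases (B : set R) : measurable B -> (forall r, B r -> Num.sg r = e) ->
    (forall r, Num.sg r = e -> B r) -> measurable [set x | Num.sg (dotv y x) = e].
  move=> mB h1 h2; rewrite (_ : mkset _ = [set x | B (dotv y x)]); first exact: half.
  by apply/seteqP; split=> x /=; [exact: h2|exact: h1].
have [e1|e1] := eqVneq e 1.
  apply: (sgn_cases `]0, +oo[%classic) => [|r|r]; first exact: measurable_itv.
    by rewrite /= in_itv/= andbT e1 => /gtr0_sg.
  by rewrite /= in_itv/= andbT e1 => /eqP; rewrite sgr_cp0.
have [e0|e0] := eqVneq e 0.
  apply: (sgn_cases [set 0]) => [|r|r] /=; first exact: measurable_set1.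
    by move=> ->; rewrite sgr0.
  by rewrite e0 => /eqP; rewrite sgr_eq0 => /eqP.
have [eN|eN] := eqVneq e (-1).
  apply: (sgn_cases `]-oo, 0[%classic) => [|r|r]; first exact: measurable_itv.
    by rewrite /= in_itv/= eN => /ltr0_sg.
  by rewrite /= in_itv/= eN => /eqP; rewrite sgr_cp0.
apply: (sgn_cases set0) => [//|//|r]; case: sgrP => _ h; move: e1 e0 eN;
  by rewrite -h eqxx.
Qed.

Lemma measurable_same_side X a : measurable [set x | same_side X x = a].
Proof.
have m1 p : measurable [set x | Num.sg (dotv (X p.1) x) == Num.sg (dotv (X p.2) x)].
  rewrite (_ : mkset _ = \bigcup_(e in [set` [:: 1; 0; -1 : R]])
      ([set x | Num.sg (dotv (X p.1) x) = e] `&` [set x | Num.sg (dotv (X p.2) x) = e])).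
    by apply: fin_bigcup_measurable => // e _; apply: measurableI; exact: measurable_sg_set.
  apply/seteqP; split=> x /=; last by move=> [e _ [-> ->]].
  move=> /eqP h; exists (Num.sg (dotv (X p.1) x)) => //=.
  by rewrite !inE; case: sgrP; rewrite eqxx ?orbT.
rewrite (_ : mkset _ = \bigcap_(p in [set: 'I_n * 'I_n])
    (if a p then [set x | Num.sg (dotv (X p.1) x) == Num.sg (dotv (X p.2) x)]
     else ~` [set x | Num.sg (dotv (X p.1) x) == Num.sg (dotv (X p.2) x)])).
  apply: fin_bigcap_measurable; first exact: finite_finset.
  by move=> p _; case: ifP => _ //; exact: measurableC.
apply/seteqP; split=> x /=.
  by move=> <- p _; rewrite ffunE; case: ifP => /= [//|/negbT/negP].
move=> h; apply/ffunP => p; rewrite ffunE.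
by have := h p I; case: (a p) => //= /negP/negbTE.
Qed.

Definition flip s X : 'I_n -> d.-tuple R :=
  fun i => [tuple (-1) ^+ s i * tnth (X i) k | k < d].

Lemma dotv_flip s X i u : dotv (flip s X i) u = (-1) ^+ s i * dotv (X i) u.
Proof. exact: dotv_tupleZ. Qed.

Lemma flipK s X : flip s (flip s X) = X.
Proof.
apply/funext => i; apply: eq_from_tnth => k.
by rewrite !tnth_mktuple mulrA -expr2 sqrr_sign mul1r.
Qed.

Lemma flip_sphere s X i : sphere d (X i) -> sphere d (flip s X i).
Proof.
by rewrite !sphereP dotv_flip dotvC dotv_flip mulrA -expr2 sqrr_sign mul1r.
Qed.

(** The pattern that arises when all opinions flipped by [s] lie strictly on one side, whichever it
    is; [s] and its complement accept the same pattern. *)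
Definition consistent s a := [forall p, a p == (s p.1 == s p.2)].

Lemma same_side_consistent s Y x (e : R) : e != 0 ->
  (forall i, Num.sg (dotv (Y i) x) = e) -> consistent s (same_side (flip s Y) x).
Proof.
move=> e0 Ye; apply/forallP => p; rewrite ffunE !dotv_flip !sgrM !Ye.
rewrite (inj_eq (mulIf e0)); apply/eqP.
have sg_sign (b : bool) : Num.sg ((-1) ^+ b : R) = (-1) ^+ b.
  by case: b; rewrite ?sgrN ?sgr1.
by rewrite !sg_sign (inj_eq signr_inj).
Qed.

Variable eta : 'I_n -> 'I_n -> R.

Definition pattern_step X a : 'I_n -> d.-tuple R :=
  fun i => proj_sphere [tuple tnth (X i) k
    + \sum_(j < n | a (j, i)) eta i j * tnth (X j) k
    - \sum_(j < n | ~~ a (j, i)) eta i j * tnth (X j) k | k < d].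

Lemma party_step_pattern X x : party_step eta X x = pattern_step X (same_side X x).
Proof.
apply/funext => i; congr proj_sphere; apply: eq_from_tnth => k.
by rewrite !tnth_mktuple; congr (_ + _ - _); apply: eq_bigl => j; rewrite ffunE.
Qed.

Lemma normv_sign (b : bool) (x : d.-tuple R) :
  normv [tuple (-1) ^+ b * tnth x k | k < d] = normv x.
Proof.
by rewrite /normv dotv_tupleZ dotvC dotv_tupleZ mulrA -expr2 sqrr_sign mul1r.
Qed.

(** An agent on the other side enters with a minus sign and carries the opposite flip, so in terms
    of [Y] every contribution has the common sign [(-1) ^+ s i], which factors out. *)
Lemma pattern_step_consistent s Y a : consistent s a ->
  pattern_step (flip s Y) a = flip s (consensus_step eta Y).
Proof.
move=> /forallP sa; apply/funext => i; rewrite /pattern_step.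
transitivity (proj_sphere [tuple (-1) ^+ s i * tnth (consensus_unnorm eta Y i) k | k < d]);
  last first.
  apply: eq_from_tnth => k.
  by rewrite /flip /consensus_step /proj_sphere !tnth_mktuple normv_sign mulrCA.
congr proj_sphere.
apply: eq_from_tnth => k; rewrite !tnth_mktuple.
rewrite mulr_sumr -addrA [X in _ + X](_ : _ = \sum_j (-1) ^+ s i * (eta i j * tnth (Y j) k)).
  rewrite (bigD1 i)//= [RHS](bigD1 i)//= addrA; congr (_ + _).
    by rewrite /mixing eqxx mulrDl mul1r mulrDr.
  by apply: eq_bigr => j ji; rewrite /mixing eq_sym (negbTE ji) add0r.
rewrite [RHS](bigID (fun j => a (j, i)))/= -sumrN; congr (_ + _); apply: eq_bigr => j aj.
  rewrite tnth_mktuple mulrCA; congr (_ ^+ _ * _).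
  by have := sa (j, i); rewrite aj => /eqP/esym/eqP /= ->.
rewrite tnth_mktuple mulrCA -mulNr; congr (_ * _).
have := sa (j, i); rewrite (negbTE aj) /= => /eqP.
by case: (s i); case: (s j); rewrite ?eqxx//= expr1 expr0 ?opprK.
Qed.

End SignPatterns.

(** * Distance to the polarized set *)

Section PolarDistance.
Context {R : realType} {n d : nat}.

Lemma polar_dist_ge0 (z : 'I_n -> d.-tuple R) (x : d.-tuple R) : sphere d x ->
  0 <= polar_dist z.
Proof.
move=> xS; apply: lb_le_inf; last by move=> r [y [s [_ ->]]]; exact: sqrtr_ge0.
by eexists; exists x, (fun=> false); split.
Qed.

(** The polarized configuration with axis [Y i0] and signs [s] competes in the infimum. *)
Lemma polar_dist_flip_le (Y : 'I_n -> d.-tuple R) (s : {ffun 'I_n -> bool}) i0 e :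
  sphere d (Y i0) -> 0 <= e -> (forall i k, `|tnth (Y i) k - tnth (Y i0) k| <= e) ->
  polar_dist (flip s Y) <= n%:R * d%:R * e.
Proof.
move=> YS e0 Ye.
pose r := Num.sqrt (\sum_(i < n) \sum_(k < d)
  (tnth (flip s Y i) k - (-1) ^+ s i * tnth (Y i0) k) ^+ 2).
apply: (@le_trans _ _ r).
  apply: ge_inf; last by exists (Y i0), s.
  by exists 0 => t [y [s' [_ ->]]]; exact: sqrtr_ge0.
have nd0 : 0 <= n%:R * d%:R * e by rewrite !mulr_ge0.
rewrite -(ger0_norm nd0) -sqrtr_sqr ler_sqrt ?sqr_ge0//.
apply: (@le_trans _ _ (\sum_(i < n) \sum_(k < d) e ^+ 2)).
  apply: ler_sum => i _; apply: ler_sum => k _.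
  rewrite tnth_mktuple -mulrBr exprMn sqrr_sign mul1r -real_normK ?num_real//.
  by apply: lerXn2r; rewrite ?nnegrE.
rewrite !sumr_const !card_ord -mulrnA -[leLHS]mulr_natl exprMn.
rewrite ler_wpM2r ?sqr_ge0// mulnC natrM expr2 -natrM -natrM ler_nat.
by case: (_ * _)%N => // m; rewrite leq_pmulr.
Qed.

End PolarDistance.

(** * Orientations with a margin *)

Section Law.
Context {R : realType} {n d : nat}.
Hypothesis d_gt0 : (0 < d)%N.
Variables (mu D : probability (d.-tuple R) R) (C : R).
Hypothesis mu_unif : is_uniform_sphere_measure mu.
Hypothesis C_gt0 : 0 < C.
Hypothesis D_sphere : D (sphere d) = 1%E.
Hypothesis D_le : forall B, measurable B -> B `<=` sphere d -> (D B <= C%:E * mu B)%E.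

Definition cone (Y : 'I_n -> d.-tuple R) (c : R) : set (d.-tuple R) :=
  [set x | sphere d x /\ forall i, c < dotv (Y i) x].

Lemma measurable_cone Y c : measurable (cone Y c).
Proof.
apply: measurableI; first exact: measurable_sphere.
rewrite (_ : (fun x => _) = \bigcap_(i in [set: 'I_n]) [set x | `]c, +oo[%classic (dotv x (Y i))]).
  apply: fin_bigcap_measurable => [|i _]; first exact: finite_finset.
  by apply: (@measurable_dotv_set _ _ (Y i)); exact: measurable_itv.
apply/seteqP; split=> x /= h i; first by move=> _; rewrite /= in_itv/= andbT dotvC.
by have := h i I; rewrite /= in_itv/= andbT dotvC.
Qed.

Lemma law_fineK B : measurable B -> (fine (D B))%:E = D B.
Proof. by move=> mB; rewrite fineK// fin_num_measure. Qed.

Lemma fine_law_le A B : measurable A -> measurable B -> A `<=` B ->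
  fine (D A) <= fine (D B).
Proof.
by move=> mA mB AB; rewrite -lee_fin !law_fineK//; apply: le_measure => //; rewrite inE.
Qed.

Lemma law_slab_le (A g : R) : 0 < A -> 0 < g < 1 ->
  exists B r, [/\ 0 < B, 0 < r < 1 & forall k y, sphere d y ->
    fine (D (slab y (A * g ^+ k))) <= B * r ^+ k].
Proof.
move=> A0 g01; have [B [r [B0 r01 muB]]] := geometric_slab d_gt0 mu_unif A0 g01.
exists (C * B), r; split => //; first exact: mulr_gt0.
move=> k y yS; rewrite -lee_fin law_fineK; last exact: measurable_slab.
apply: le_trans (D_le (measurable_slab _ _) _) _; first by move=> x [].
by rewrite -mulrA EFinM; apply: lee_wpmul2l (muB k y yS); rewrite lee_fin ltW.
Qed.

Lemma law_bigsetU_le (I : Type) (s : seq I) (A : I -> set (d.-tuple R)) :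
  (forall i, measurable (A i)) ->
  fine (D (\big[setU/set0]_(i <- s) A i)) <= \sum_(i <- s) fine (D (A i)).
Proof.
move=> mA; elim: s => [|i s IH]; first by rewrite !big_nil measure0.
have ms : measurable (\big[setU/set0]_(i <- s) A i) by exact: bigsetU_measurable.
rewrite !big_cons; apply: le_trans (lerD (lexx _) IH).
rewrite -lee_fin EFinD !law_fineK//; last exact: measurableU.
exact: measureU2.
Qed.

(** Outside the slabs around the hyperplanes orthogonal to the [X i], the signs of the inner
    products put [x] into the cone of exactly one orientation. Thin slabs leave at least half of the
    mass to finitely many cones. *)
Lemma exists_orientation : exists c kappa, [/\ 0 < c, 0 < kappa &
  forall X : 'I_n -> d.-tuple R, (forall i, sphere d (X i)) ->
    exists s, kappa <= fine (D (cone (flip s X) c))].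
Proof.
have h12 : 0 < (2^-1 : R) < 1 by apply/andP; split; lra.
have [B [r [B0 r01 DB]]] := law_slab_le ltr01 h12.
(* The factor [n.+1] instead of [n] keeps the coefficient positive when there are no agents. *)
have [k Bk] : exists k, n.+1%:R * B * r ^+ k <= 2^-1.
  by apply: geometric_small; rewrite ?mulr_gt0// invr_gt0.
pose c := 1 * (2^-1 : R) ^+ k.
have c0 : 0 < c by rewrite mulr_gt0// exprn_gt0// invr_gt0.
pose M := #|{ffun 'I_n -> bool}|%:R : R.
have M0 : 0 < M by rewrite ltr0n; apply/card_gt0P; exists [ffun=> true].
(* If every cone had smaller mass, cones and slabs together would have at most [1 / 4 + 1 / 2], less
   than the mass of the sphere. *)
exists c, (4 * M)^-1; split; [exact: c0|by rewrite invr_gt0 mulr_gt0|].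
move=> X XS; apply: contrapT => none.
have small s : fine (D (cone (flip s X) c)) <= (4 * M)^-1.
  by rewrite leNgt; apply/negP => h; apply: none; exists s; exact: ltW.
pose slabs := \big[setU/set0]_(i < n) slab (X i) c.
have slabsP x : slabs x <-> exists i, slab (X i) c x.
  rewrite /slabs -bigcup_seq; split=> [[i _ h]|[i h]]; exists i => //=.
  exact: mem_index_enum.
have m_slabs : measurable slabs by apply: bigsetU_measurable => i _; exact: measurable_slab.
pose E : set (d.-tuple R) := sphere d `\` slabs.
have mE : measurable E by apply: measurableD => //; exact: measurable_sphere.
pose f (x : d.-tuple R) := [ffun i => dotv (X i) x < 0].
have inE_cone s : E `&` [set x | f x = s] = cone (flip s X) c.
  apply/seteqP; split => x /=.
    move=> [[xS xslab] <-]; split=> // i.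
    have : ~ slab (X i) c x.
      by move=> h; apply: xslab; apply/slabsP; exists i.
    rewrite dotv_flip ffunE /slab /= dotvC => /not_andP[//|/negP].
    rewrite -ltNge; have [h|h] := ltrP (dotv (X i) x) 0.
      by rewrite ltr0_norm// expr1 mulN1r.
    by rewrite ger0_norm// expr0 mul1r.
  move=> [xS xc]; split; last first.
    apply/ffunP => i; rewrite ffunE; have := xc i; rewrite dotv_flip.
    by case: (s i); rewrite ?expr1 ?mulN1r ?expr0 ?mul1r => h; [apply/idP|apply/negbTE];
       rewrite -?leNgt; lra.
  split => //; move/slabsP => [i [_]].
  have := xc i; rewrite dotv_flip dotvC => h1 h2.
  have := lt_le_trans h1 (le_trans (ler_norm _) _).
  by rewrite normrM normr_sign mul1r => /(_ _ h2); rewrite ltxx.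
have DE : fine (D E) <= 4^-1.
  rewrite -lee_fin law_fineK// (@measure_fin_partition _ _ _ _ D f E); last first.
    by move=> s; rewrite inE_cone; exact: measurable_cone.
  apply: (@le_trans _ _ (\sum_(s : {ffun 'I_n -> bool}) ((4 * M)^-1)%:E)%E).
    apply: lee_sum => s _; rewrite inE_cone.
    by have := small s; rewrite -lee_fin law_fineK//; exact: measurable_cone.
  rewrite sumEFin lee_fin sumr_const -[leLHS]mulr_natl -/M.
  by rewrite le_eqVlt; apply/orP; left; apply/eqP; field; rewrite gt_eqF.
have Dslabs : fine (D slabs) <= 2^-1.
  apply: le_trans Bk; apply: le_trans (law_bigsetU_le _ _) _.
    by move=> i; exact: measurable_slab.
  apply: (@le_trans _ _ (\sum_(i < n) B * r ^+ k)).
    by apply: ler_sum => i _; exact: DB.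
  rewrite sumr_const card_ord -[leLHS]mulr_natl -mulrA ler_wpM2r ?ler_nat//.
  by move/andP: r01 => [r0 _]; rewrite mulr_ge0 ?exprn_ge0 ?ltW.
have : (1 <= D E + D slabs)%E.
  rewrite -D_sphere; apply: (@le_trans _ _ (D (E `|` slabs))); last exact: measureU2.
  apply: le_measure; rewrite ?inE; [exact: measurable_sphere|exact: measurableU|].
  by move=> x xS; have [h|h] := pselect (slabs x); [right|left].
rewrite -(law_fineK mE) -(law_fineK m_slabs) -EFinD lee_fin; lra.
Qed.

End Law.

(* [p k] is a lower bound for the probability that a run of age [k] never ends. *)
Lemma survival_bounds (R : realType) (kappa B r : R) : 0 < kappa <= 1 -> 0 < B -> 0 < r < 1 ->
  exists p : nat -> R, (forall k, 0 < p k <= 1) /\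
    forall k q, kappa <= q -> 1 - B * r ^+ k <= q -> p k <= q * p k.+1.
Proof.
move=> /andP[ka0 ka1] B0 /andP[r0 r1].
(* The tail of the geometric series of failure bounds from age [k] on. *)
pose S k := B / (1 - r) * r ^+ k.
have S0 k : 0 < S k by rewrite mulr_gt0 ?exprn_gt0// divr_gt0// subr_gt0.
have SS k : S k = B * r ^+ k + S k.+1.
  by rewrite /S exprS; field; rewrite gt_eqF// subr_gt0.
have [K SK] : exists K, S K <= 2^-1.
  by apply: geometric_small; rewrite ?r0 ?invr_gt0// divr_gt0// subr_gt0.
have S_le k : (K <= k)%N -> S k <= 2^-1.
  move=> Kk; apply: le_trans SK; apply: ler_wpM2l; first by rewrite divr_ge0 ?subr_ge0// ltW.
  by rewrite ler_wiXn2l// ltW.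
(* From age [K] on the union bound leaves at least one half; every earlier step costs a factor
   [kappa]. *)
exists (fun k => if (K <= k)%N then 1 - S k else kappa ^+ (K - k) / 2); split.
  move=> k; case: ifP => [Kk|_]; first by have := S0 k; have := S_le k Kk; lra.
  have : 0 < kappa ^+ (K - k) by rewrite exprn_gt0.
  have : kappa ^+ (K - k) <= 1 by rewrite exprn_ile1// ltW.
  lra.
move=> k q kq eq.
have [Kk|kK] := leqP K k.
  rewrite (leqW Kk); have h := S_le k.+1 (leqW Kk).
  apply: (@le_trans _ _ ((1 - B * r ^+ k) * (1 - S k.+1))); last by rewrite ler_wpM2r//; lra.
  have : 0 <= B * r ^+ k * S k.+1.
    apply: mulr_ge0; last exact: ltW (S0 _).
    by rewrite mulr_ge0 ?exprn_ge0 ?(ltW B0) ?(ltW r0).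
  by rewrite (SS k); lra.
(* At age [K - 1] the two formulas meet, because [1 - S K] is at least one half. *)
have [Kk1|kK1] := leqP K k.+1.
  have -> : (K - k = 1)%N by move: kK Kk1; lia.
  have := S_le _ Kk1 => h; rewrite expr1.
  apply: (@le_trans _ _ (kappa * (1 - S k.+1))); first by rewrite ler_wpM2l//; lra.
  by rewrite ler_wpM2r//; lra.
have -> : (K - k = (K - k.+1).+1)%N by move: kK1; lia.
by rewrite exprS -mulrA ler_wpM2r// divr_ge0// exprn_ge0// (ltW ka0).
Qed.

(** * Runs *)

Section AlmostSurelyBounded.
Context {R : realType} {dT : measure_display} {T : measurableType dT}.
Variable P : probability T R.

(** By monotonicity in [t], the event that the count ever exceeds [m] is an increasing union and
    inherits the bound [K / m.+1]; unboundedness lies in all these events. *)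
Lemma ae_bounded (N : nat -> T -> nat) (K : R) : 0 < K ->
  (forall t m, measurable [set w | (m <= N t w)%N]) ->
  (forall t w, (N t w <= N t.+1 w)%N) ->
  (forall t m, (P [set w | (m.+1 <= N t w)%N] <= (K / m.+1%:R)%:E)%E) ->
  \forall w \ae P, exists m, forall t, (N t w <= m)%N.
Proof.
move=> K0 mN Nmono PN.
pose F m t := [set w | (m.+1 <= N t w)%N].
pose B m := \bigcup_t F m t.
have mB m : measurable (B m) by apply: bigcup_measurable => t _; exact: mN.
have PB m : (P (B m) <= (K / m.+1%:R)%:E)%E.
  have cvgB : (P \o F m) t @[t --> \oo] --> P (B m).
    apply: nondecreasing_cvg_mu; [by move=> t; exact: mN|exact: mB|].
    move=> t t' tt'; apply/subsetPset => w /=.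
    rewrite /F/= => /leq_trans; apply.
    by elim: t' tt' => [|t' IH]; [rewrite leqn0 => /eqP ->|
      rewrite leq_eqVlt => /orP[/eqP ->//|/IH/leq_trans]; apply].
  rewrite -(cvg_lim _ cvgB)//; apply: lime_le; first by apply/cvg_ex; exists (P (B m)).
  by near=> t; exact: PN.
exists (\bigcap_m B m); split.
- by apply: bigcapT_measurable.
- have mI : measurable (\bigcap_m B m) by apply: bigcapT_measurable.
  have PI m : fine (P (\bigcap_m B m)) <= K / m.+1%:R.
    rewrite -lee_fin fineK ?fin_num_measure//; apply: le_trans (PB m).
    by apply: le_measure; rewrite ?inE// => w; apply.
  rewrite -[LHS]fineK ?fin_num_measure//; congr (_%:E).
  apply/eqP; rewrite eq_le fine_ge0// andbT leNgt; apply/negP.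
  move: (fine _) PI => x PI x0; have := PI (Num.trunc (K / x)).
  rewrite leNgt ltr_pdivrMr// mulrC -ltr_pdivrMr// => /negP; apply.
  exact: truncnS_gt.
move=> w /= nb m _; apply: contrapT => h; apply: nb; exists m => t.
by rewrite leqNgt; apply/negP => h'; apply: h; exists t.
Unshelve. all: by end_near.
Qed.

End AlmostSurelyBounded.

Section Process.
Context {R : realType} {n d : nat}.
Variables (eta : 'I_n -> 'I_n -> R) (X0 : 'I_n -> d.-tuple R).
Variable best : ('I_n -> d.-tuple R) -> {ffun 'I_n -> bool}.
Hypothesis X0_sphere : forall i, sphere d (X0 i).

(* A run lasts as long as the sign patterns agree with the orientation chosen
   at its start; [fails] counts the runs that have ended. *)
Record state := State {
  base : 'I_n -> d.-tuple R;
  orient : {ffun 'I_n -> bool};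
  age : nat;
  fails : nat }.

(** Computed from the start of the run, so that one cone, that of [base s], serves the run at every
    age. *)
Definition aligned (s : state) := iter (age s) (consensus_step eta) (base s).
Definition config (s : state) := flip (orient s) (aligned s).

Definition restart X N := State (flip (best X) X) (best X) 0 N.

(* Restarting from [X0] off the sphere keeps the invariants of [state]; almost
   surely this never happens. *)
Definition repair (X : 'I_n -> d.-tuple R) :=
  if `[< forall i, sphere d (X i) >] then X else X0.

Definition next (s : state) a :=
  if consistent (orient s) a
  then State (base s) (orient s) (age s).+1 (fails s)
  else restart (repair (pattern_step eta (config s) a)) (fails s).+1.

Definition pat (s : state) x := same_side (config s) x.

Lemma config_restart X N : config (restart X N) = X.
Proof. by rewrite /config /aligned /= flipK. Qed.

Lemma repair_sphere X i : sphere d (repair X i).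
Proof. by rewrite /repair; case: asboolP. Qed.

Lemma config_next s x : (forall i, sphere d (party_step eta (config s) x i)) ->
  config (next s (pat s x)) = party_step eta (config s) x.
Proof.
move=> stepS; rewrite party_step_pattern -/(pat s x) /next.
case: ifP => [cons|_]; first by rewrite [RHS]pattern_step_consistent.
rewrite config_restart /repair asboolT// => i.
by have := stepS i; rewrite party_step_pattern.
Qed.

Lemma fails_next s a : (fails s <= fails (next s a))%N.
Proof. by rewrite /next; case: ifP. Qed.

Lemma fails_next_eq s a : fails (next s a) = fails s ->
  next s a = State (base s) (orient s) (age s).+1 (fails s).
Proof. by rewrite /next; case: ifP => //= _ /eqP; rewrite gtn_eqF. Qed.

Hypothesis d_gt0 : (0 < d)%N.
Hypothesis n_gt0 : (0 < n)%N.
Hypothesis eta_ge0 : forall i j, 0 <= eta i j.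
Variables (D : probability (d.-tuple R) R) (c kappa A b B r : R).
Hypothesis D_sphere : D (sphere d) = 1%E.
Hypothesis c_gt0 : 0 < c.
Hypothesis kappa_gt0 : 0 < kappa.
Hypothesis bestP : forall X, (forall i, sphere d (X i)) ->
  kappa <= fine (D (cone (flip (best X) X) c)).
Hypothesis contracts : forall (Y : 'I_n -> d.-tuple R) v,
  (forall j, sphere d (Y j)) -> sphere d v -> (forall j, c <= dotv (Y j) v) ->
  forall k i j l, `|tnth (iter k (consensus_step eta) Y i) l
                    - tnth (iter k (consensus_step eta) Y j) l| <= A * b ^+ k.
Hypothesis slab_bound : forall k y, sphere d y ->
  fine (D (slab y (d%:R * A * b ^+ k))) <= B * r ^+ k.

Definition admissible (s : state) :=
  (forall i, sphere d (base s i)) /\ kappa <= fine (D (cone (base s) c)).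

Lemma admissible_restart X N : (forall i, sphere d (X i)) -> admissible (restart X N).
Proof. by move=> XS; split=> [i|]; [exact: flip_sphere|exact: bestP]. Qed.

Lemma admissible_next s a : admissible s -> admissible (next s a).
Proof.
move=> [sS sc]; rewrite /next; case: ifP => // _.
by apply: admissible_restart; exact: repair_sphere.
Qed.

(** A cone of positive mass is not empty. *)
Lemma admissible_direction s : admissible s ->
  exists2 v, sphere d v & forall j, c <= dotv (base s j) v.
Proof.
move=> [_ sc]; apply: contrapT => none.
have c0 : cone (base s) c = set0.
  apply/seteqP; split=> // v [vS vc]; apply: none; exists v => // j; exact: ltW.
by move: sc; rewrite c0 measure0 leNgt kappa_gt0.
Qed.

Lemma aligned_sphere s i : admissible s -> sphere d (aligned s i).
Proof.
move=> sA; have [v vS vc] := admissible_direction sA.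
by have [] := consensus_iter_sphere_margin eta_ge0 (age s) sA.1 c_gt0 vc i.
Qed.

Lemma aligned_diff s i j l : admissible s ->
  `|tnth (aligned s i) l - tnth (aligned s j) l| <= A * b ^+ age s.
Proof.
move=> sA; have [v vS vc] := admissible_direction sA.
exact: contracts sA.1 vS vc _ _ _ _.
Qed.

Definition stay (s : state) : set (d.-tuple R) :=
  [set x | consistent (orient s) (pat s x)].

Lemma measurable_pat s a : measurable [set x | pat s x = a].
Proof. exact: measurable_same_side. Qed.

Lemma measurable_stay s : measurable (stay s).
Proof.
rewrite (_ : stay s = \bigcup_(a in [set a | consistent (orient s) a]) [set x | pat s x = a]).
  by apply: fin_bigcup_measurable => [|a _]; [exact: finite_finset|exact: measurable_pat].
apply/seteqP; split=> x /=; first by exists (pat s x).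
by move=> [a /= h xa]; rewrite /stay/= xa.
Qed.

(** Consensus steps preserve positive inner products, so every [x] in the cone of [base s] keeps the
    run going at any age. *)
Lemma stay_ge_kappa s : admissible s -> kappa <= fine (D (stay s)).
Proof.
move=> [_ sc]; apply: le_trans sc _; apply: fine_law_le.
- exact: measurable_cone.
- exact: measurable_stay.
move=> x [_ xc]; apply: (@same_side_consistent _ _ _ _ _ _ 1); first exact: oner_neq0.
move=> i; apply: gtr0_sg; apply: consensus_iter_gt0 => // j.
exact: lt_trans (xc j).
Qed.

(** The aligned opinions form a cluster, so an [x] off the slab of width [e] around one of them sees
    all of them with the same nonzero sign. *)
Lemma stay_ge_slab s : admissible s -> 1 - B * r ^+ age s <= fine (D (stay s)).
Proof.
move=> sA; pose i0 := Ordinal n_gt0; pose y := aligned s i0.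
have yS : sphere d y by exact: aligned_sphere.
(* Two aligned opinions differ by at most [A * b ^+ age s] in each of the [d] coordinates, and the
   coordinates of [x] are at most 1. *)
pose e := d%:R * A * b ^+ age s.
have m_slab : measurable (slab y e) by exact: measurable_slab.
have m_stay := measurable_stay s.
have : (1 <= D (stay s) + D (slab y e))%E.
  rewrite -D_sphere; apply: (@le_trans _ _ (D (stay s `|` slab y e))); last exact: measureU2.
  apply: le_measure; rewrite ?inE; [exact: measurable_sphere|exact: measurableU|].
  move=> x xS; have [xe|xe] := leP `|dotv x y| e; first by right.
  left; apply: (@same_side_consistent _ _ _ _ _ _ (Num.sg (dotv y x))).
    rewrite sgr_eq0 dotvC -normr_gt0; apply: le_lt_trans xe.
    rewrite /e -mulrA mulr_ge0//; apply: le_trans (aligned_diff i0 i0 (Ordinal d_gt0) sA).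
    exact: normr_ge0.
  move=> i; have diff : `|dotv (aligned s i) x - dotv y x| <= e.
    rewrite /dotv -sumrB; apply: le_trans (ler_norm_sum _ _ _) _.
    rewrite /e -mulrA mulr_natl -[X in _ *+ X]card_ord -sumr_const; apply: ler_sum => k _.
    rewrite -mulrBl normrM -[leRHS]mulr1 ler_pM// ?sphere_coord_le1//.
    exact: aligned_diff.
  by apply: sg_eq diff; rewrite dotvC.
rewrite -(law_fineK D m_stay) -(law_fineK D m_slab) -EFinD lee_fin.
by have := slab_bound (age s) yS; rewrite -/e; lra.
Qed.

Variable p : nat -> R.
Hypothesis p01 : forall k, 0 < p k <= 1.
Hypothesis p_step : forall k q, kappa <= q -> 1 - B * r ^+ k <= q -> p k <= q * p k.+1.

(** Divided by [p 0], this bounds the expected total number of failures: those so far, plus at most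
    [(1 - p (age s)) / p 0] to come. *)
Definition potential (s : state) : R := p 0 * (fails s)%:R + (1 - p (age s)).

Let law_sum s (Q : pred {ffun 'I_n * 'I_n -> bool}) :
  \sum_(a | Q a) fine (D [set x | pat s x = a]) = fine (D [set x | Q (pat s x)]).
Proof.
have mE : measurable [set x | Q (pat s x)].
  rewrite (_ : mkset _ = \bigcup_(a in [set a | Q a]) [set x | pat s x = a]).
    by apply: fin_bigcup_measurable => [|a _]; [exact: finite_finset|exact: measurable_pat].
  apply/seteqP; split=> x /=; first by exists (pat s x).
  by move=> [a /= h ->].
apply/EFin_inj; rewrite -sumEFin law_fineK//.
rewrite (@measure_fin_partition _ _ _ _ D (pat s) [set x | Q (pat s x)]); last first.
  by move=> a; apply: measurableI => //; exact: measurable_pat.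
rewrite big_mkcond; apply: eq_bigr => a _; case: ifP => Qa.
  rewrite law_fineK; last exact: measurable_pat.
  by congr (D _); apply/seteqP; split => x /=; [move=> xa; rewrite xa|case].
rewrite (_ : _ `&` _ = set0) ?measure0//.
by apply/seteqP; split=> // x [/= + xa]; rewrite xa Qa.
Qed.

(** A failure adds [p 0] and resets the second term to [1 - p 0], together 1. The mean of the second
    part is thus [1 - q * p (age s).+1], at most [1 - p (age s)] by the choice of [p]. *)
Lemma potential_supermartingale s : admissible s ->
  branch_mean (fun B => fine (D B)) pat next potential s <= potential s.
Proof.
move=> sA; have q1 := stay_ge_kappa sA; have q2 := stay_ge_slab sA.
have := p_step q1 q2; set q := fine (D (stay s)) => pq.
have D1 : \sum_a fine (D [set x | pat s x = a]) = 1.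
  rewrite (law_sum s xpredT) (_ : mkset _ = setT) ?probability_setT//.
  by apply/seteqP; split.
have Dq : \sum_(a | consistent (orient s) a) fine (D [set x | pat s x = a]) = q.
  exact: law_sum.
have Dq' : \sum_(a | ~~ consistent (orient s) a) fine (D [set x | pat s x = a]) = 1 - q.
  by have := D1; rewrite (bigID (consistent (orient s)))/= Dq; lra.
rewrite /branch_mean (bigID (consistent (orient s)))/=.
rewrite (eq_bigr (fun a => fine (D [set x | pat s x = a]) *
  (p 0 * (fails s)%:R + (1 - p (age s).+1)))); last first.
  by move=> a ca; rewrite /next ca.
rewrite -mulr_suml Dq (eq_bigr (fun a => fine (D [set x | pat s x = a]) *
  (p 0 * (fails s).+1%:R + (1 - p 0)))); last first.
  by move=> a /negbTE ca; rewrite /next ca.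
rewrite -mulr_suml Dq' /potential -natr1.
have -> : q * (p 0 * (fails s)%:R + (1 - p (age s).+1)) +
  (1 - q) * (p 0 * ((fails s)%:R + 1) + (1 - p 0)) =
  p 0 * (fails s)%:R + (1 - q * p (age s).+1) by ring.
by rewrite lerD2l lerD2l lerN2.
Qed.

(** * Almost sure polarization of the trajectory *)

Section Trajectory.
Import numFieldNormedType.Exports.
Context {dT : measure_display} {T : measurableType dT} {P : probability T R}.
Variable xi : nat -> T -> d.-tuple R.
Hypothesis xi_meas : forall t, measurable_fun setT (xi t).
Hypothesis xi_indep : mutually_independent P xi.
Hypothesis xi_law : forall t C, measurable C -> P (xi t @^-1` C) = (fine (D C))%:E.

Definition process t w : state := run xi pat next (restart X0 0) 0 t w.

Lemma processS t w : process t.+1 w = next (process t w) (pat (process t w) (xi t w)).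
Proof. exact: run_recr. Qed.

Lemma process_admissible t w : admissible (process t w).
Proof.
elim: t => [|t IH]; first exact: admissible_restart.
by rewrite processS; exact: admissible_next.
Qed.

(** The potential starts at [1 - p 0], at most 1, so having at least [m.+1] failures has probability
    at most [(p 0)^-1 / m.+1]. *)
Lemma process_fails_bounded :
  \forall w \ae P, exists m, forall t, (fails (process t w) <= m)%N.
Proof.
have p0_gt0 : 0 < p 0 by have /andP[] := p01 0.
apply: (@ae_bounded _ _ _ _ _ (p 0)^-1); first by rewrite invr_gt0.
- move=> t m.
  exact: (measurable_run xi_meas next measurable_pat _ _ _ [set s | (m <= fails s)%N]).
- by move=> t w; rewrite processS fails_next.
move=> t m.
have c0 : 0 < p 0 * m.+1%:R by rewrite mulr_gt0.
have next_adm s a : admissible s -> admissible (next s a) by exact: admissible_next.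
have V0 s : 0 <= 1 - p (age s) by have /andP[_] := p01 (age s); rewrite subr_ge0.
have pot0 s : admissible s -> 0 <= potential s.
  by move=> _; rewrite addr_ge0 ?mulr_ge0 ?(ltW p0_gt0).
have FV s : admissible s -> (m.+1 <= fails s)%N -> p 0 * m.+1%:R <= potential s.
  move=> _ mf; apply: (@le_trans _ _ (p 0 * (fails s)%:R)).
    by rewrite ler_wpM2l ?ler_nat// ltW.
  by rewrite lerDl.
apply: le_trans (run_supermartingale xi_meas xi_indep xi_law measurable_pat t c0
  next_adm pot0 potential_supermartingale FV (admissible_restart 0 X0_sphere)) _.
rewrite lee_fin /potential /= mulr0 add0r invfM.
by rewrite ler_piMl ?mulr_ge0 ?invr_ge0 ?(ltW p0_gt0)//; lra.
Qed.

(** As long as the trajectory stays on the sphere, [repair] changes nothing. *)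
Lemma config_process w :
  (forall t i, sphere d (party_traj eta X0 (fun s => xi s w) t i)) ->
  forall t, config (process t w) = party_traj eta X0 (fun s => xi s w) t.
Proof.
move=> trajS; elim=> [|t IH]; first exact: config_restart.
rewrite processS config_next IH//=; exact: (trajS t.+1).
Qed.

Hypothesis A_gt0 : 0 < A.
Hypothesis b01 : 0 < b < 1.

Lemma traj_polarizes w : (exists m, forall t, (fails (process t w) <= m)%N) ->
  (forall t i, sphere d (party_traj eta X0 (fun s => xi s w) t i)) ->
  (fun t => polar_dist (party_traj eta X0 (fun s => xi s w) t)) @ \oo --> 0.
Proof.
move=> [m fm] trajS.
have exN : exists N, `[< exists t, fails (process t w) = N >].
  by exists (fails (process 0 w)); apply/asboolP; exists 0%N.
have ubN N : `[< exists t, fails (process t w) = N >] -> (N <= m)%N.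
  by move=> /asboolP[t <-].
(* The failure count attains its maximum at [t0]; afterwards the current run never ends and only its
   age grows. *)
case: (ex_maxnP exN ubN) => N /asboolP[t0 ft0] maxN.
have runE j : process (j + t0) w =
    State (base (process t0 w)) (orient (process t0 w)) (j + age (process t0 w)) N.
  elim: j => [|j IH]; first by rewrite !add0n -ft0; case: (process t0 w).
  rewrite addSn processS fails_next_eq; first by rewrite IH.
  have fj : fails (process (j + t0) w) = N by rewrite IH.
  apply/eqP; rewrite eqn_leq fails_next andbT -processS [leqRHS]fj.
  by apply: maxN; apply/asboolP; exists (j + t0).+1.
pose u t := polar_dist (party_traj eta X0 (fun s => xi s w) t).
suff : (fun j => u (j + t0)%N) @ \oo --> (0 : R) by rewrite (cvg_shiftn t0 u).
pose K := n%:R * d%:R * (A * b ^+ age (process t0 w)).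
have /andP[b0 b1] := b01.
apply: (@squeeze_cvgr _ _ _ _ (fun=> 0) (fun j => K * b ^+ j)).
- near=> j; rewrite /u -config_process//; apply/andP; split.
    exact: polar_dist_ge0 (X0_sphere (Ordinal n_gt0)).
  have -> : K * b ^+ j = n%:R * d%:R * (A * b ^+ age (process (j + t0) w)).
    have -> : age (process (j + t0) w) = (j + age (process t0 w))%N by rewrite runE.
    by rewrite /K exprD; move: (b ^+ age _) (b ^+ j) => q q'; ring.
  have sA := process_admissible (j + t0) w.
  rewrite /config; move: (process _ w) sA => s sA.
  apply: (@polar_dist_flip_le _ _ _ _ _ (Ordinal n_gt0)); first exact: aligned_sphere.
    by rewrite mulr_ge0 ?exprn_ge0// ltW.
  by move=> i k; exact: aligned_diff.
- exact: cvg_cst.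
rewrite -[X in _ --> X](mulr0 K); apply: cvgMr.
by apply: cvg_expr; rewrite gtr0_norm.
Unshelve. all: by end_near.
Qed.

End Trajectory.
End Process.

Lemma law_exists (R : realType) (dT dU : measure_display) (T : measurableType dT)
    (U : measurableType dU) (P : probability T R) (f : T -> U) :
  measurable_fun setT f -> exists D : probability U R, forall B, D B = P (f @^-1` B).
Proof.
move=> mf.
pose F : {mfun T >-> U} := HB.pack f (isMeasurableFun.Build _ _ _ _ f mf).
by exists (distribution P F).
Qed.

Unset Implicit Arguments.

Theorem theorem3p7 (R : realType) (n d : nat) (eta : 'I_n -> 'I_n -> R)
  (dT : measure_display) (T : measurableType dT) (P : probability T R)
  (xi : nat -> T -> d.-tuple R) (mu : probability (d.-tuple R) R)
  (X0 : 'I_n -> d.-tuple R) :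
  (1 <= n)%N -> (1 <= d)%N ->
  (forall i j, 0 <= eta i j) ->
  (* A is irreducible: A^n > 0 entrywise *)
  (forall i j, 0 < (adj_matrix eta ^+ n) i j) ->
  (* mu is the uniform probability measure on S^{d-1} *)
  is_uniform_sphere_measure mu ->
  (* xi_0, xi_1, ... are i.i.d. with law D on S^{d-1} *)
  (forall t, measurable_fun setT (xi t)) ->
  mutually_independent P xi ->
  identically_distributed P xi ->
  (forall t, P (xi t @^-1` sphere d) = 1%E) ->
  (exists C C' : R, 0 < C /\ 0 < C' /\
     forall t (B : set (d.-tuple R)), measurable B -> B `<=` sphere d ->
       ((C%:E * mu B <= P (xi t @^-1` B))%E /\
        (P (xi t @^-1` B) <= C'%:E * mu B)%E)) ->
  (* starting configuration in (S^{d-1})^n *)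
  (forall i, sphere d (X0 i)) ->
  (* standing assumption: the unnormalized update vectors are nonzero *)
  (\forall w \ae P, forall t i,
      party_unnorm eta (party_traj eta X0 (fun s => xi s w) t) (xi t w) i
      != [tuple 0 | _ < d]) ->
  (* conclusion: almost surely rho(X_t, P) -> 0 *)
  \forall w \ae P,
    (fun t => polar_dist (party_traj eta X0 (fun s => xi s w) t)) @ \oo --> 0.
Proof.
move=> n_gt0 d_gt0 eta_ge0 irred mu_unif xi_meas xi_indep xi_id xi_sphere.
move=> [C0 [C [_ [C_gt0 dens]]]] X0_sphere nonzero.
have [D DE] := law_exists P (xi_meas 0).
have D_sphere : D (sphere d) = 1%E by rewrite DE.
have D_le B : measurable B -> B `<=` sphere d -> (D B <= C%:E * mu B)%E.
  by move=> mB BS; rewrite DE; have [] := dens 0 B mB BS.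
have xi_law t B : measurable B -> P (xi t @^-1` B) = (fine (D B))%:E.
  by move=> mB; rewrite law_fineK// (xi_id t B mB) DE.
have [c [kappa [c_gt0 kappa_gt0 orientP]]] :=
  @exists_orientation R n d d_gt0 mu D C mu_unif C_gt0 D_sphere D_le.
(* The default orientation can only be taken for configurations off the sphere. *)
pose best X : {ffun 'I_n -> bool} :=
  xget [ffun=> false] [set s | kappa <= fine (D (cone (flip s X) c))].
have bestP X : (forall i, sphere d (X i)) -> kappa <= fine (D (cone (flip (best X) X) c)).
  by move=> /orientP XS; exact: (xgetPex _ XS).
have kappa_le1 : kappa <= 1.
  apply: le_trans (bestP _ X0_sphere) _; rewrite -lee_fin law_fineK.
    by apply: probability_le1; exact: measurable_cone.
  exact: measurable_cone.
have [A [b [A_gt0 b01 contracts]]] := @consensus_contracts R n d eta eta_ge0 irred c n_gt0 c_gt0.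
have dA_gt0 : 0 < d%:R * A by rewrite mulr_gt0// ltr0n.
have [B [r [B_gt0 r01 slab_bound]]] := law_slab_le d_gt0 mu_unif C_gt0 D_le dA_gt0 b01.
have kappa01 : 0 < kappa <= 1 by rewrite kappa_gt0.
have [p [p01 p_step]] := survival_bounds kappa01 B_gt0 r01.
have bounded := process_fails_bounded X0_sphere d_gt0 n_gt0 eta_ge0 D_sphere c_gt0
  kappa_gt0 bestP contracts slab_bound p01 p_step xi_meas xi_indep xi_law.
apply: filterS2 bounded nonzero => w fw nz.
(* Nonvanishing of the unnormalized vectors keeps the trajectory on the sphere, so it coincides with
   the process of runs. *)
have trajS t i : sphere d (party_traj eta X0 (fun s => xi s w) t i).
  by case: t => [|t] //=; apply: proj_sphereP; exact: nz.
exact: (traj_polarizes X0_sphere n_gt0 eta_ge0 c_gt0 kappa_gt0 bestP contracts A_gt0 b01 fw trajS).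
Qed.
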